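(* Assume the following hypothesis: there exists a real number $A\ge 2$ such that, for every sufficiently large positive integer $l$ and every integer $b$ with $\gcd(b,l)=1$, there exists a prime $p\equiv b \pmod l$ with $p<l(\log l)^A$. Then for any integer $a$ and any natural number $\nu$ with $\gcd(a,\nu)=1$ and with $a$ and $\nu$ of opposite parity, $$C_\nu(X,a)\ \geq\ X^{1-(2+o(1))\frac{\log\log\log\log X}{\log\log\log X}}\qquad (X\to\infty).$$
   Context: For an integer $a$, an $(a,a)$-Carmichael number is a squarefree natural number $n$ such that for every prime $p$, $p\mid n$ implies $(p-a)\mid (n-a)$. For such an $n$ with prime factors $p_1,\dots,p_m$, set $K=\gcd(p_1-a,\dots,p_m-a)$. For a natural number $\nu$, $C_\nu(X,a)$ denotes the number of $(a,a)$-Carmichael numbers $n\le X$ for which $K=\nu$. Here $\log$ is the natural logarithm, and $o(1)$ denotes a quantity tending to $0$ as $X\to\infty$ with $a$, $\nu$ and $A$ fixed. *)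

(* Defs.v *)
From HB Require Import structures.
From mathcomp Require Import all_boot all_order all_algebra.
From mathcomp Require Import all_classical all_reals all_analysis.

Set Implicit Arguments.
Unset Strict Implicit.
Unset Printing Implicit Defensive.

Import Order.TTheory GRing.Theory Num.Theory.
Import numFieldNormedType.Exports.

Local Open Scope ring_scope.

(* A square d ^ 2 dividing n > 0 has d <= n, so bounding d loses nothing;
   the divisor d = 0 excludes n = 0. *)
Definition squarefree (n : nat) : bool :=
  [forall d : 'I_n.+1, (d ^ 2 %| n)%N ==> (d == 1%N :> nat)].

(* Neither n = 1 nor n prime is excluded. If p = a divides n then, since
   0 divides only 0, the condition at p says n = a. *)
Definition aa_carmichael (a : int) (n : nat) : bool :=
  squarefree n && all (fun p : nat => (p%:Z - a %| n%:Z - a)%Z) (primes n).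

Definition carmichael_gcd (a : int) (n : nat) : int :=
  \big[gcdz/0]_(p <- primes n) (p%:Z - a).

(* For 0 <= X, n <= Num.truncn X is equivalent to n%:R <= X. *)
Definition carmichael_count (R : realType) (nu : nat) (X : R) (a : int) : nat :=
  #|[set n : 'I_(Num.truncn X).+1 |
      aa_carmichael a n && (carmichael_gcd a n == nu%:Z)]|.

Definition small_primes_in_progressions (R : realType) (A : R) : Prop :=
  exists l0 : nat, forall l : nat, (0 < l)%N -> (l0 <= l)%N ->
    forall b : int, coprimez b l%:Z ->
      exists p : nat, [/\ prime p,
        (p%:Z = b %[mod l%:Z])%Z &
        (p%:R : R) < l%:R * (ln (l%:R : R)) `^ A].

(* Main.v *)
Require Import Defs.
From HB Require Import structures.
From mathcomp Require Import all_boot all_order all_algebra.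
From mathcomp Require Import fingroup zmodp cyclic algC cyclotomic classfun character.
From mathcomp Require Import zify ring lra.

Set Implicit Arguments.
Unset Strict Implicit.
Unset Printing Implicit Defensive.

Import Order.TTheory GRing.Theory Num.Theory.

(** The proof adapts the construction of Alford, Granville and Pomerance, with
    the hypothesis used at two levels.

    Fix a large s and put y = 2 ^ s. First, among the products m of s distinct
    primes up to y, the hypothesis gives many primes q = m k + 1 with one
    common small k; by Chebyshev's bound and pigeonhole there are about y ^ (s
    - 2 log s) of them, with log in base 2, below about y ^ s
    ([smooth_primes]), and every q - 1 divides y! k. So, if L is the product
    of such q, the exponent of (Z/L)^* is only exp (y ^ (1 + o(1))), although
    L itself is doubly exponential in s ^ 2. Second, among the products d of u
    = y ^ 2 primes q, it gives many primes p = a + nu d k1 with one common k1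
    ([prime_pool]). A last use gives a prime p* = a + M, where M is a multiple
    of nu k1 L.

    If U is a set of such p with product 1 modulo M, then n = p* (prod U) is
    congruent to p*, hence to a, modulo M, and every p - a divides M, hence n
    - a. The gcd K would be a multiple of k1, so two pools are used, built
    from disjoint halves of the primes q and from coprime cofactors k1, k2; a
    fixed nonempty product-one set U' from the second pool is multiplied in,
    and then K = nu ([carmichael_from_pools]).

    Product-one subsets exist in every set of more than E log |G| elements of
    an abelian group G of exponent E ([product_one_subset]). Splitting each
    t-subset of a pool of N primes into a maximal product-one part and a small
    remainder shows that there are at least C(N, t) / (N + 1) ^ n of them,
    with n = E log |G| ([count_closed_subsets]).

    If the primes of the pool are at most x, then log N / log x is 1 - (2 log
    s + O(1)) / s with the same log: the loss 2 log s / s is the cost of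
    replacing integers up to y ^ s by squarefree products of s primes up to y,
    half of it for the density of the primes and half for the factorial of s.
    All other losses are O(1/s), so the count up to X is at least X ^ (1 - (2
    log s + O(1)) / s). Here log log X is comparable to s 2 ^ s, so that, in
    natural logarithms, s is asymptotic to log log log X / log 2, and the
    exponent becomes the claimed one.

    For a = 0, where nu = 1, the numbers 2 p with p an odd prime are already
    numerous enough. *)

(** * Product-one subsets in finite abelian groups *)

Lemma popular_fiber (T I : finType) (f : T -> I) (S : {set T}) :
  0 < #|I| -> exists i, #|S| <= #|I| * #|[set x in S | f x == i]|.
Proof.
case: (pickP (pred_of_simpl (@predT I))) => [i0 _ _|I0]; last by rewrite (eq_card0 I0).
pose F i := #|[set x in S | f x == i]|.
exists [arg max_(i > i0) F i]; case: arg_maxnP => // i _ imax.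
rewrite -sum1_card (partition_big f predT) //= -sum_nat_const.
apply: leq_sum => j _; apply: leq_trans (imax j isT).
by rewrite sum1dep_card /F; apply/eq_leq/eq_card => x; rewrite !inE.
Qed.

(** Treating the elements of s one at a time, c i is chosen as the value at g
    i taken by most of the characters that have escaped so far. There are at
    most E possible values, the E-th roots of unity, so each step keeps at
    most the fraction 1 - 1/E of the surviving characters. *)
Lemma irr_greedy_cover (gT : finGroupType) (G : {group gT}) (E : nat) (T : finType)
    (g : T -> gT) (s : seq T) :
  abelian G -> 0 < E -> (forall x, x \in G -> (x ^+ E)%g = 1%g) ->
  {in s, forall i, g i \in G} -> uniq s ->
  exists c : T -> algC, (forall i, c i != 0%R) /\
    #|[set j : Iirr G | all (fun i => ('chi_j (g i) != c i)%R) s]| * E ^ size s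
      <= #|G| * E.-1 ^ size s.
Proof.
move=> cGG E_gt0 expG; elim: s => [|i s IHs] sG us.
  exists (fun=> 1%R); split=> [i|]; first exact: oner_neq0.
  by rewrite !expn0 !muln1 -(card_Iirr_abelian cGG) max_card.
move: us => /= /andP[is' us'].
have [j js|c [c0 cs]] := IHs _ us'; first by apply: sG; rewrite inE js orbT.
set S := [set j : Iirr G | _] in cs.
have [z z_prim] := C_prim_root_exists E_gt0.
have giG : g i \in G by apply: sG; rewrite mem_head.
have fP (j : Iirr G) : {k : 'I_E | 'chi_j (g i) = z ^+ k}%R.
  apply: (prim_rootP z_prim).
  have lin_j := (char_abelianP G cGG) j.
  by rewrite -lin_charX // expG // lin_char1.
pose f j := sval (fP j).
have [|k] := popular_fiber f S; first by rewrite card_ord.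
rewrite card_ord => Sk.
set Sf := [set j in S | f j == k] in Sk.
exists (fun i' => if i' == i then z ^+ k else c i')%R; split.
  move=> i'; case: ifP => // _; rewrite expf_neq0 //.
  apply: contra_eq_neq (prim_expr_order z_prim) => ->.
  by rewrite expr0n eqn0Ngt E_gt0 eq_sym oner_neq0.
set S' := [set j : Iirr G | _].
have subS : S' \subset S :\: Sf.
  apply/subsetP => j; rewrite !inE /= eqxx => /andP[jk js].
  have jS : all (fun i => ('chi_j (g i) != c i)%R) s.
    apply/allP => i' i's; move/allP: js => /(_ _ i's).
    by case: ifP => // /eqP E0; rewrite E0 (negbTE is') in i's.
  rewrite jS /= ?andbT ?andTb; apply: contra jk => /eqP <-.
  by rewrite /f; case: (fP j) => /= k' ->.
have SfS : Sf \subset S by apply/subsetP => j; rewrite inE => /andP[].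
have cardS' : #|S'| <= #|S| - #|Sf|.
  by rewrite (leq_trans (subset_leq_card subS)) // cardsD (setIidPr SfS).
rewrite /= !expnS.
have le1 : #|S'| * E <= #|S| * E.-1.
  apply: leq_trans (_ : (#|S| - #|Sf|) * E <= _); first by rewrite leq_mul2r cardS' orbT.
  rewrite mulnBl -subn1 mulnBr muln1 leq_sub2l //.
  by rewrite mulnC.
rewrite mulnA; apply: leq_trans (leq_mul le1 (leqnn _)) _.
by rewrite -mulnA mulnCA [X in _ <= X]mulnCA leq_mul2l cs orbT.
Qed.

Lemma sum_irr_abelian (gT : finGroupType) (G : {group gT}) (x : gT) :
  abelian G -> (\sum_(j : Iirr G) 'chi_j x = #|G|%:R *+ (x == 1%g))%R.
Proof.
move=> cGG; rewrite -cfRegE cfReg_sum sum_cfunE; apply: eq_bigr => j _.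
by rewrite cfunE lin_char1 ?mul1r //; apply: (char_abelianP G cGG).
Qed.

(** With c from [irr_greedy_cover], every character kills the product of the g
    i - c i in the group algebra, so that product is 0. But its coefficient at
    1 is the product of the - c i, which is not 0, unless some nonempty
    subproduct of the g i equals 1. *)
Theorem product_one_subset (gT : finGroupType) (G : {group gT}) (E : nat) (T : finType)
    (g : T -> gT) (A : {set T}) :
  abelian G -> 0 < E -> (forall x, x \in G -> (x ^+ E)%g = 1%g) ->
  {in A, forall i, g i \in G} -> #|G| * E.-1 ^ #|A| < E ^ #|A| ->
  exists B : {set T}, [/\ B \subset A, B != set0 & (\prod_(i in B) g i)%g = 1%g].
Proof.
move=> cGG E_gt0 expG AG ltE.
case: (pickP [pred B : {set T} | [&& B \subset A, B != set0 &
    (\prod_(i in B) g i)%g == 1%g]]) => [B /and3P[? ? /eqP ?]|noB].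
  by exists B.
have [||c [c0 cle]] := irr_greedy_cover cGG E_gt0 expG (_ : {in enum A, forall i, g i \in G}).
- by move=> i; rewrite mem_enum; apply: AG.
- exact: enum_uniq.
exfalso; rewrite -cardE in cle.
set S := [set j | _] in cle.
have S0 : #|S| = 0.
  apply/eqP; rewrite -leqn0 leqNgt; apply/negP => S_gt0.
  have := leq_trans (leq_mul S_gt0 (leqnn _)) cle.
  by rewrite mul1n leqNgt ltE.
pose h (i : T) (j : Iirr G) : algC := (if i \in A then 'chi_j (g i) else 0)%R.
pose d (i : T) : algC := (if i \in A then - c i else 1)%R.
have zero : (\sum_(j : Iirr G) \prod_i (h i j + d i) = 0)%R.
  apply: big1 => j _; apply/eqP.
  have: j \notin S by rewrite (cards0_eq S0) inE.
  rewrite inE => /allPn[i]; rewrite mem_enum negbK => iA /eqP cE.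
  rewrite (bigD1 i) //= mulf_eq0; apply/orP; left.
  by rewrite /h /d iA cE subrr.
have expand (j : Iirr G) : (\prod_i (h i j + d i) =
    \sum_(B : {set T}) (\prod_(i | i \notin B) d i) * \prod_(i in B) h i j)%R.
  rewrite bigA_distr; apply: eq_bigr => B _.
  rewrite (bigID (mem B)) /= mulrC; congr (_ * _)%R.
    by apply: eq_bigr => i /negbTE ->.
  by apply: eq_bigr => i ->.
move: zero; under eq_bigr do rewrite expand.
rewrite exchange_big (bigD1 set0) //= [X in (_ + X)%R]big1; last first.
  move=> B Bn0; rewrite -mulr_sumr.
  have [BA|/subsetPn[i iB iA]] := boolP (B \subset A); last first.
    rewrite [X in (_ * X)%R]big1 ?mulr0 // => j _.
    by rewrite (bigD1 i) //= /h (negbTE iA) mul0r.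
  have BE (j : Iirr G) : (\prod_(i in B) h i j = 'chi_j (\prod_(i in B) g i)%g)%R.
    rewrite lin_char_prod ?(char_abelianP G cGG) //.
      by apply: eq_bigr => i iB; rewrite /h (subsetP BA).
    by move=> i iB; apply: AG; apply: (subsetP BA).
  rewrite (eq_bigr _ (fun j _ => BE j)).
  have := noB B; rewrite /= BA Bn0 /= => nB1.
  by rewrite sum_irr_abelian // nB1 mulr0n mulr0.
rewrite addr0 -mulr_sumr.
under [X in (_ * X)%R]eq_bigr do rewrite big_set0.
rewrite sumr_const card_Iirr_abelian //.
apply/eqP; rewrite mulf_eq0 negb_or pnatr_eq0 -lt0n cardG_gt0 andbT.
apply/prodf_neq0 => i _; rewrite /d; case: ifP => _; last exact: oner_neq0.
by rewrite oppr_eq0.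
Qed.

(** Compare with the binomial expansion of (|A| + 1) ^ n. *)
Lemma card_small_subsets (T : finType) (A : {set T}) n :
  #|[set W : {set T} | (W \subset A) && (#|W| < n)]| <= #|A|.+1 ^ n.
Proof.
have bin_le N j : 'C(N, j) <= N ^ j.
  apply: leq_trans (_ : 'C(N, j) * j`! <= _); first by rewrite leq_pmulr ?fact_gt0.
  by rewrite bin_ffact ffact_prod -[j in X in _ <= X]card_ord -prod_nat_const leq_prod // => i _; rewrite leq_subr.
rewrite -sum1_card (partition_big (fun W : {set T} => inord #|W| : 'I_n.+1) predT) //=.
rewrite -(addn1 #|A|) addnC expnDn.
apply: leq_sum => j _; rewrite exp1n mul1n.
have [jn|jn] := leqP n j.
  rewrite big1 // => W; rewrite inE => /andP[/andP[_ Wn] /eqP Wj].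
  have := inordK (leqW Wn); rewrite Wj => jW.
  by move: Wn; rewrite -jW ltnNge jn.
apply: leq_trans (_ : 'C(#|A|, j) <= _); last first.
  apply: leq_trans (bin_le _ _) _; rewrite leq_pmull // bin_gt0; lia.
rewrite -cards_draws sum1dep_card; apply/subset_leq_card/subsetP => W.
rewrite !inE => /andP[/andP[-> Wn] /eqP <-] /=.
by rewrite inordK // ltnW.
Qed.

(** Cutting a t-subset S of A into a largest subset of S satisfying Z and the
    rest is injective, and the rest has fewer than n elements: otherwise it
    would contain a nonempty set satisfying Z to be added. So the number of
    t-subsets is at most the number of Z-sets times the number of sets with
    fewer than n elements. *)
Lemma count_closed_subsets (T : finType) (Z : pred {set T}) (A : {set T}) (n t : nat) :
  Z set0 ->
  (forall B C : {set T}, [disjoint B & C] -> Z B -> Z C -> Z (B :|: C)) ->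
  (forall C : {set T}, C \subset A -> n <= #|C| ->
     exists B : {set T}, [/\ B \subset C, B != set0 & Z B]) ->
  'C(#|A|, t) <= #|[set U : {set T} | [&& U \subset A, Z U, t < #|U| + n & #|U| <= t]]|
                   * #|A|.+1 ^ n.
Proof.
move=> Z0 ZU Zex.
pose good (S U : {set T}) := (U \subset S) && Z U.
pose m (S : {set T}) : {set T} := [arg max_(U > set0 | good S U) #|U|].
have mP (S : {set T}) : S \subset A -> [/\ m S \subset S, Z (m S) & #|S :\: m S| < n].
  move=> SA; rewrite /m; case: arg_maxnP; first by rewrite /good sub0set Z0.
  move=> U /andP[US ZU'] Umax; split=> //.
  rewrite ltnNge; apply/negP => nle.
  have [|B [BS Bn0 ZB]] := Zex _ _ nle.
    by apply: subset_trans SA; apply: subsetDl.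
  have dis : [disjoint U & B].
    rewrite -setI_eq0 -subset0; apply/subsetP => x; rewrite inE => /andP[xU xB].
    by move/(subsetP BS): xB; rewrite !inE xU.
  have /Umax : good S (U :|: B).
    rewrite /good ZU // andbT subUset US /=.
    by apply: subset_trans BS _; apply: subsetDl.
  move: dis; rewrite -setI_eq0 => /eqP dis.
  rewrite cardsU dis cards0 subn0 /=.
  by move: Bn0; rewrite -card_gt0 => ?; lia.
pose F (S : {set T}) := (m S, S :\: m S).
set D := [set S : {set T} | S \subset A & #|S| == t].
set C1 := [set U : {set T} | _].
pose C2 := [set W : {set T} | (W \subset A) && (#|W| < n)].
rewrite -cards_draws -/D.
have injF : {in D &, injective F}.
  move=> S1 S2; rewrite !inE => /andP[S1A _] /andP[S2A _] [e1 e2].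
  have [s1 _ _] := mP _ S1A; have [s2 _ _] := mP _ S2A.
  have e (S : {set T}) : m S \subset S -> S = m S :|: (S :\: m S).
    by move=> s; rewrite -{1}(setID S (m S)) (setIidPr s).
  by rewrite (e _ s1) e2 e1 -(e _ s2).
rewrite -(card_in_imset injF).
apply: leq_trans (_ : #|setX C1 C2| <= _); last first.
  by rewrite cardsX leq_mul2l card_small_subsets orbT.
apply/subset_leq_card/subsetP => _ /imsetP[S SD ->].
move: SD; rewrite !inE /= => /andP[SA /eqP St].
have [mS ZmS smallD] := mP _ SA.
rewrite (subset_trans mS SA) ZmS smallD (subset_trans (subsetDl _ _) SA) /= !andbT.
move: smallD; rewrite cardsD (setIidPr mS) St -St => h.
have := subset_leq_card mS; lia.
Qed.

(** * Product-one subsets modulo an integer *)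

(** W and L need not be coprime. After Euler modulo W, the power h is 1 modulo
    lcm(W, L); then h - 1 and the sum of the h ^ i for i < gcd(W, L)
    contribute the factors lcm(W, L) and gcd(W, L) of h ^ gcd(W, L) - 1. *)
Lemma exp_eq1_mul_modulus (W L K p : nat) :
  0 < W -> 0 < L -> coprime p (W * L) -> p ^ K = 1 %[mod L] ->
  p ^ (K * totient W * gcdn W L) = 1 %[mod W * L].
Proof.
move=> W0 L0; have [->|p0] := posnP p.
  by rewrite /coprime gcd0n => /eqP-> _; rewrite !modn1.
rewrite coprimeMr => /andP[pW pL] pK.
set h := p ^ (K * totient W).
have h0 : 0 < h by rewrite expn_gt0 p0.
have hW : h = 1 %[mod W].
  by rewrite /h mulnC expnM -modnXm Euler_exp_totient // modnXm exp1n.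
have hL : h = 1 %[mod L] by rewrite /h expnM -modnXm pK modnXm exp1n.
have hl : lcmn W L %| h - 1.
  by rewrite dvdn_lcm -!eqn_mod_dvd // hW hL !eqxx.
rewrite expnM -/h -muln_lcm_gcd; apply/eqP; rewrite eqn_mod_dvd ?expn_gt0 ?p0 //.
rewrite subn1 predn_exp -subn1; apply: dvdn_mul => //.
set g := gcdn W L.
have hg : h = 1 %[mod g].
  apply/eqP; rewrite eqn_mod_dvd //; apply: dvdn_trans hl.
  by apply: dvdn_trans (dvdn_gcdl _ _) (dvdn_lcml _ _).
rewrite /dvdn -modn_summ (eq_bigr (fun=> 1 %% g)); last first.
  by move=> i _; rewrite -modnXm hg modnXm exp1n.
by rewrite modn_summ sum1_card card_ord modnn.
Qed.

Lemma double_pow_pred E : 0 < E -> 2 * E.-1 ^ E <= E ^ E.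
Proof.
case: E => // F _; rewrite succnK.
have bern n : F ^ n + n * F ^ n.-1 <= F.+1 ^ n.
  elim: n => [|n IHn]; first by rewrite mul0n.
  rewrite [X in _ <= X]expnS; apply: leq_trans (leq_mul (leqnn _) IHn).
  rewrite /= expnS; case: n {IHn} => [|n] /=; first by rewrite !expn0; lia.
  rewrite !expnS; nia.
apply: leq_trans (bern _); rewrite /= expnS; lia.
Qed.

(** In the greedy choice each block of E elements at least halves the number
    of surviving characters, by [double_pow_pred], and (Z/M)^* has fewer than
    2 ^ m characters. *)
Theorem product_one_subset_mod (M E m : nat) (T : finType) (f : T -> nat) (A : {set T}) :
  1 < M -> 0 < E -> (forall x, coprime x M -> x ^ E = 1 %[mod M]) ->
  {in A, forall i, coprime (f i) M} -> M < 2 ^ m -> E * m <= #|A| ->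
  exists B : {set T}, [/\ B \subset A, B != set0 & \prod_(i in B) f i = 1 %[mod M]].
Proof.
move=> M1 E0 expM Af Mm EA.
pose G := units_Zp M.
pose u i : {unit 'Z_M} := insubd (1%g : {unit 'Z_M}) ((f i)%:R : 'Z_M)%R.
have uE i : i \in A -> val (u i) = ((f i)%:R)%R.
  move=> iA; rewrite /u insubdK //.
  by rewrite -topredE /= unitZpE // coprime_sym Af.
have eqM (x y : nat) : (x%:R = y%:R :> 'Z_M)%R -> x = y %[mod M].
  by move=> /(congr1 val) /=; rewrite !val_Zp_nat.
have Meq (x y : nat) : x = y %[mod M] -> (x%:R = y%:R :> 'Z_M)%R.
  by move=> xy; rewrite -(Zp_nat_mod M1 x) xy Zp_nat_mod.
have uexp (v : {unit 'Z_M}) : (v ^+ E = 1)%g.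
  apply/val_inj; rewrite FinRing.val_unitX FinRing.val_unit1.
  set w := val v.
  have cw : coprime (w : nat) M.
    rewrite coprime_sym -unitZpE // natr_Zp. by rewrite /w; case: (v).
  transitivity (((w : nat)%:R : 'Z_M) ^+ E)%R; first by rewrite natr_Zp.
  by rewrite -natrX; apply: (Meq _ 1 (expM _ cw)).
have [|||||B [BA Bn0 B1]] := @product_one_subset _ (units_Zp_group M) E T u A.
- exact: units_Zp_abelian.
- exact: E0.
- by move=> v _; apply: uexp.
- by move=> i _; rewrite inE.
- rewrite /= card_units_Zp; last by lia.
  have tM : totient M < 2 ^ m.
    apply: leq_ltn_trans Mm; rewrite totient_count_coprime.
    rewrite -[X in _ <= X]subn0 -[X in _ <= X]muln1 -sum_nat_const_nat.
    by apply: leq_sum => i _; case: coprime.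
  have [k ->] : exists k, #|A| = E * m + k by exists (#|A| - E * m); lia.
  rewrite !expnD mulnA.
  have kE : E.-1 ^ k <= E ^ k by case: (k) => [|j] //; rewrite leq_exp2r //; lia.
  apply: leq_ltn_trans (leq_mul (leqnn _) kE) _.
  rewrite ltn_pmul2r ?expn_gt0 ?E0 // !expnM.
  case: (posnP ((E.-1 ^ E) ^ m)) => [->|EE0].
    by rewrite muln0 !expn_gt0 E0.
  apply: leq_trans (_ : 2 ^ m * (E.-1 ^ E) ^ m <= _); first by rewrite ltn_pmul2r.
  by rewrite -expnMn; case: (m) => // j; rewrite leq_exp2r // double_pow_pred.
exists B; split=> //.
apply: eqM; rewrite natr_prod -(eq_bigr _ (fun i iB => uE i (subsetP BA i iB))).
have uM := @FinRing.val_unitM 'Z_M.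
have u1 := @FinRing.val_unit1 'Z_M.
by have := congr1 val B1; rewrite u1 (big_morph val uM u1) => ->.
Qed.

(** * Numbers given as products of distinct primes *)

Lemma prod_primes_gt0 (s : seq nat) : all prime s -> 0 < \prod_(p <- s) p.
Proof.
move=> /allP s_pr; rewrite big_seq; apply: prodn_cond_gt0 => p /s_pr.
exact: prime_gt0.
Qed.

Lemma mem_primes_prod (s : seq nat) :
  all prime s -> primes (\prod_(p <- s) p) =i s.
Proof.
elim: s => [|p s IHs] /= => [_ x|/andP[p_pr s_pr] x]; first by rewrite big_nil.
rewrite big_cons primesM ?prod_primes_gt0 // ?prime_gt0 //.
by rewrite primes_prime // !inE IHs.
Qed.

Lemma prod_primes_inj (s1 s2 : seq nat) :
  all prime s1 -> all prime s2 -> \prod_(p <- s1) p = \prod_(p <- s2) p -> s1 =i s2.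
Proof. by move=> h1 h2 e x; rewrite -mem_primes_prod // e mem_primes_prod. Qed.

Lemma squarefree_prod (s : seq nat) :
  uniq s -> all prime s -> squarefree (\prod_(p <- s) p).
Proof.
move=> us s_pr; apply/forallP => d; apply/implyP => ds.
have P0 := prod_primes_gt0 s_pr.
have d0 : 0 < d by rewrite lt0n; apply: contraL ds => /eqP ->; rewrite dvd0n -lt0n.
rewrite eqn_leq d0 andbT leqNgt; apply/negP => d1.
have p_pr := pdiv_prime d1; set p := pdiv d in p_pr.
have p2 : p ^ 2 %| \prod_(p <- s) p by apply: dvdn_trans ds; apply: dvdn_exp2r; apply: pdiv_dvd.
have ps : p \in s.
  by rewrite -mem_primes_prod // mem_primes p_pr P0 (dvdn_trans _ p2) // expnS dvdn_mulr.
move: p2; rewrite (perm_big _ (perm_to_rem ps)) big_cons expnS expn1 dvdn_pmul2l ?prime_gt0 //.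
move=> pr.
have : p \in rem p s.
  have r_pr : all prime (rem p s) by apply/allP => x /mem_rem /(allP s_pr).
  rewrite -mem_primes_prod // mem_primes p_pr pr andbT /=.
  exact: prod_primes_gt0.
by rewrite mem_rem_uniq // !inE eqxx.
Qed.

Lemma dvdz_biggcd (s : seq nat) (f : nat -> int) (d : int) :
  {in s, forall p, (d %| f p)%Z} -> (d %| \big[gcdz/0%R]_(p <- s) f p)%Z.
Proof.
elim: s => [|p s IHs] ds; first by rewrite big_nil dvdz0.
rewrite big_cons dvdz_gcd ds ?mem_head //= IHs // => q qs.
by apply: ds; rewrite inE qs orbT.
Qed.

Lemma biggcd_dvdz (s : seq nat) (f : nat -> int) p :
  p \in s -> (\big[gcdz/0%R]_(q <- s) f q %| f p)%Z.
Proof.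
elim: s => [//|q s IHs]; rewrite inE big_cons => /orP[/eqP ->|/IHs]; first exact: dvdz_gcdl.
by apply: dvdz_trans; apply: dvdz_gcdr.
Qed.

(** Two primes whose shifts have gcd nu already force the whole gcd, since nu
    divides the other shifts. *)
Lemma carmichael_gcd_eq (a : int) (nu n p q : nat) :
  p \in primes n -> q \in primes n -> gcdz (p%:Z - a)%R (q%:Z - a)%R = Posz nu ->
  {in primes n, forall r : nat, (Posz nu %| (r%:Z - a)%R)%Z} ->
  carmichael_gcd a n = Posz nu.
Proof.
move=> pn qn pq nudvd; apply/eqP; rewrite /carmichael_gcd.
set g := \big[_/_]_(_ <- _) _.
have g0 : (0 <= g)%R.
  by rewrite /g; case: (primes n) => [|x s]; rewrite ?big_nil ?big_cons.
have d1 : (Posz nu %| g)%Z by apply: dvdz_biggcd.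
have d2 : (g %| Posz nu)%Z by rewrite -pq dvdz_gcd !(biggcd_dvdz (fun r : nat => r%:Z - a)%R).
move: g0 d1 d2; case: g => // g _; rewrite !dvdzE /= => d1 d2.
by rewrite eqz_nat eqn_dvd d1 d2.
Qed.

(** * Carmichael numbers from two pools of primes *)

Definition carmichael_ncount (nu X : nat) (a : int) : nat :=
  #|[set n : 'I_X.+1 | aa_carmichael a n && (carmichael_gcd a n == Posz nu)]|.

Lemma carmichael_ncount_ge (T : finType) (C : {set T}) (F : T -> nat) nu X a :
  {in C &, injective F} ->
  {in C, forall U, [/\ F U <= X, aa_carmichael a (F U) &
     carmichael_gcd a (F U) = Posz nu]} ->
  #|C| <= carmichael_ncount nu X a.
Proof.
move=> injF FC.
have injI : {in C &, injective (fun U => inord (F U) : 'I_X.+1)}.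
  move=> U V UC VC /(congr1 (@nat_of_ord _)).
  have [FU _ _] := FC _ UC; have [FV _ _] := FC _ VC.
  by rewrite !inordK ?ltnS //; apply: injF.
rewrite -(card_in_imset injI); apply/subset_leq_card/subsetP => _ /imsetP[U UC ->].
by have [FU FC1 FC2] := FC _ UC; rewrite inE inordK ?ltnS // FC1 FC2 eqxx.
Qed.

Definition in_pool (a : int) (nu M x : nat) (p : nat) : bool :=
  [&& prime p, coprime p M, ((p%:Z - a)%R %| Posz M)%Z,
      (Posz nu %| (p%:Z - a)%R)%Z & p <= x].

(** The numbers counted are n = ps * (prod of U2) * (prod of U), where U2 is
    one fixed nonempty subset of P2 with product 1 modulo M and U ranges over
    the product-one subsets of P1 with more than t - E m and at most t
    elements. All the shifts p - a divide M, and n = ps = a modulo M. Having a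
    prime of each pool among the factors makes the gcd equal to nu. *)
Theorem carmichael_from_pools (a : int) (nu M ps E m t x X : nat) (P1 P2 : seq nat) :
  1 < M -> prime ps -> Posz ps = (a + M%:Z)%R ->
  uniq P1 -> uniq P2 -> all (in_pool a nu M x) P1 -> all (in_pool a nu M x) P2 ->
  ps \notin P1 -> ps \notin P2 ->
  {in P1 & P2, forall p q, gcdz (p%:Z - a)%R (q%:Z - a)%R = Posz nu} ->
  {in P1, forall p, p \notin P2} -> (Posz nu %| Posz M)%Z ->
  0 < E -> (forall z, coprime z M -> z ^ E = 1 %[mod M]) -> M < 2 ^ m ->
  0 < m -> E * m <= size P2 -> E * m <= t -> ps * (x ^ (E * m) * x ^ t) <= X ->
  'C(size P1, t) <= carmichael_ncount nu X a * (size P1).+1 ^ (E * m).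
Proof.
move=> M1 ps_pr psE u1 u2 /allP P1P /allP P2P ps1 ps2 gcd12 dis12 nuM E0 expM Mm m0 n2 nt leX.
set n := E * m in n2 nt leX *.
have n0 : 0 < n by rewrite muln_gt0 E0.
pose f1 (i : 'I_(size P1)) := nth 0 P1 i.
pose f2 (i : 'I_(size P2)) := nth 0 P2 i.
have f1P i : f1 i \in P1 by apply: mem_nth.
have f2P i : f2 i \in P2 by apply: mem_nth.
have f1I : injective f1.
  by move=> i j /eqP; rewrite nth_uniq // => /eqP/val_inj.
have f2I : injective f2.
  by move=> i j /eqP; rewrite nth_uniq // => /eqP/val_inj.
(* Only E m elements of P2 are used, which keeps U2 small. *)
have [A2 [_ cA2]] : exists A2 : {set 'I_(size P2)}, A2 \subset setT /\ #|A2| = n.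
  have : 0 < #|[set A : {set 'I_(size P2)} | A \subset setT & #|A| == n]|.
    by rewrite cards_draws cardsT card_ord bin_gt0.
  by case/card_gt0P => A2; rewrite !inE => /andP[? /eqP ?]; exists A2.
have f2M : {in A2, forall i, coprime (f2 i) M}.
  by move=> i _; have /and5P[] := P2P _ (f2P i).
have [|U2 [U2A U2n0 U2M]] := product_one_subset_mod M1 E0 expM f2M Mm; first by rewrite cA2.
pose Z (U : {set 'I_(size P1)}) : bool := \prod_(i in U) f1 i == 1 %[mod M].
have Z0 : Z set0 by rewrite /Z big_set0.
have ZU (B C : {set 'I_(size P1)}) : [disjoint B & C] -> Z B -> Z C -> Z (B :|: C).
  move=> dBC /eqP ZB /eqP ZC; rewrite /Z.
  rewrite (eq_bigl [predU B & C]) => [|i]; last by rewrite !inE.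
  rewrite bigU //=.
  by rewrite -modnMml ZB modnMml mul1n ZC.
have Zex (C : {set 'I_(size P1)}) : C \subset setT -> n <= #|C| ->
    exists B : {set 'I_(size P1)}, [/\ B \subset C, B != set0 & Z B].
  move=> _ nC.
  have f1M : {in C, forall i, coprime (f1 i) M}.
    by move=> i _; have /and5P[] := P1P _ (f1P i).
  have [//|B [BC Bn0 /eqP BM]] := product_one_subset_mod M1 E0 expM f1M Mm.
  by exists B.
have := count_closed_subsets t Z0 ZU Zex.
rewrite cardsT card_ord; set C1 := [set U | _] => /leq_trans; apply.
rewrite leq_mul2r; apply/orP; right.
pose s (U : {set 'I_(size P1)}) := ps :: [seq f2 i | i <- enum U2] ++ [seq f1 i | i <- enum U].
pose F U := \prod_(p <- s U) p.
have FE U : F U = ps * (\prod_(i in U2) f2 i * \prod_(i in U) f1 i).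
  by rewrite /F big_cons big_cat !big_map -!big_enum.
have s_pr U : all prime (s U).
  rewrite /= ps_pr /= all_cat; apply/andP; split; apply/allP => p /mapP[i _ ->].
    by have /and5P[] := P2P _ (f2P i).
  by have /and5P[] := P1P _ (f1P i).
have us U : uniq (s U).
  rewrite /= mem_cat cat_uniq !map_inj_uniq // !enum_uniq /= ?andbT.
  apply/andP; split.
    rewrite negb_or; apply/andP; split.
      by apply: contra ps2 => /mapP[i _ ->].
    by apply: contra ps1 => /mapP[i _ ->].
  apply/hasPn => p /mapP[i _ ->]; apply/mapP => -[j _ e].
  by have := dis12 _ (f1P i); rewrite e f2P.
have x0 : 0 < x.
  have /set0Pn[i _] := U2n0.
  by have /and5P[/prime_gt0 p0 _ _ _] := P2P _ (f2P i); apply: leq_trans.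
apply: (carmichael_ncount_ge (F := F)) => [U V UC VC FUV|U].
  have sUV := prod_primes_inj (s_pr U) (s_pr V) FUV.
  have f1s (W : {set 'I_(size P1)}) i : (f1 i \in s W) = (i \in W).
    rewrite inE mem_cat (mem_map f1I) mem_enum.
    have -> : f1 i == ps = false by apply: contraNF ps1 => /eqP <-.
    have -> // : f1 i \in [seq f2 i | i <- enum U2] = false.
    by apply: contraNF (dis12 _ (f1P i)) => /mapP[j _ ->].
  by apply/setP => i; rewrite -!f1s.
rewrite inE => /and4P[_ /eqP ZU1 tU Ut].
(* The lower bound on the size of U is needed to get a prime of P1 in n. *)
have U0 : U != set0 by rewrite -card_gt0; move: nt tU; clear; lia.
have U2n : #|U2| <= n by rewrite -cA2 subset_leq_card.
split.
- rewrite FE; apply: leq_trans leX; rewrite leq_mul2l leq_mul ?orbT //.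
    apply: leq_trans (_ : x ^ #|U2| <= _); last exact: leq_pexp2l.
    rewrite -prod_nat_const; apply: leq_prod => i _.
    by have /and5P[] := P2P _ (f2P i).
  apply: leq_trans (_ : x ^ #|U| <= _); last exact: leq_pexp2l.
  rewrite -prod_nat_const; apply: leq_prod => i _.
  by have /and5P[] := P1P _ (f1P i).
- rewrite /aa_carmichael [squarefree _](squarefree_prod (us U) (s_pr U)) /=.
  apply/allP => p; rewrite (mem_primes_prod (s_pr U)) => ps'.
  have pM : ((p%:Z - a)%R %| Posz M)%Z.
    move: ps'; rewrite inE mem_cat => /or3P[/eqP ->|/mapP[i _ ->]|/mapP[i _ ->]].
    + by rewrite psE addrAC subrr add0r dvdzz.
    + by have /and5P[] := P2P _ (f2P i).
    + by have /and5P[] := P1P _ (f1P i).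
  apply: dvdz_trans pM _.
  have MF : (Posz M %| ((F U)%:Z - ps%:Z)%R)%Z.
    rewrite -eqz_mod_dvd; apply/eqP; rewrite !modz_nat; congr Posz.
    rewrite FE -modnMmr -[X in _ * X]modnMml U2M modnMml mul1n ZU1.
    by rewrite modnMmr muln1.
  rewrite -/(F U); have -> : ((F U)%:Z - a = ((F U)%:Z - ps%:Z) + M%:Z)%R by rewrite psE; ring.
  by rewrite rpredD // dvdzz.
have /set0Pn[i1 i1U] := U0; have /set0Pn[i2 i2U] := U2n0.
apply: (@carmichael_gcd_eq _ _ _ (f1 i1) (f2 i2)).
- by rewrite (mem_primes_prod (s_pr U)) inE mem_cat (mem_map f1I) mem_enum i1U !orbT.
- by rewrite (mem_primes_prod (s_pr U)) inE mem_cat (mem_map f2I) mem_enum i2U !orbT.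
- exact: gcd12.
move=> r; rewrite (mem_primes_prod (s_pr U)) inE mem_cat.
case/or3P=> [/eqP ->|/mapP[i _ ->]|/mapP[i _ ->]].
- by rewrite psE addrAC subrr add0r.
- by have /and5P[] := P2P _ (f2P i).
- by have /and5P[] := P1P _ (f1P i).
Qed.

(** * Primes in progressions with a coprimality condition on the cofactor *)

(** The number of binary digits of a positive n: an integer stand-in for the
    logarithm, which keeps all the estimates in nat. *)
Definition lg (n : nat) : nat := (trunc_log 2 n).+1.

Definition linnik_bound (B l0 : nat) : Prop :=
  forall l, 0 < l -> l0 <= l -> forall b : int, coprimez b (Posz l) ->
  exists p, [/\ prime p, (Posz p = b %[mod Posz l])%Z & p < l * lg l ^ B].

Lemma ltn_lg n : n < 2 ^ lg n.
Proof. exact: trunc_log_ltn. Qed.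

Lemma lg_le n k : n < 2 ^ k -> 0 < k -> lg n <= k.
Proof.
move=> nk k0; rewrite /lg; case: (posnP n) => [->|n0]; first by rewrite trunc_log0.
rewrite -(ltn_exp2l _ _ (ltnSn 1)); apply: leq_ltn_trans nk.
exact: trunc_logP.
Qed.

Lemma coprime_by_primes x y :
  0 < y -> (forall r, prime r -> r %| y -> ~~ (r %| x)) -> coprime x y.
Proof.
move=> y0 h; rewrite /coprime; apply/eqP.
have g0 : 0 < gcdn x y by rewrite gcdn_gt0 y0 orbT.
case: (ltngtP (gcdn x y) 1) => // [|g1]; first by rewrite ltnS leqNgt g0.
have := h _ (pdiv_prime g1) (dvdn_trans (pdiv_dvd _) (dvdn_gcdr x y)).
by rewrite (dvdn_trans (pdiv_dvd _) (dvdn_gcdl x y)).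
Qed.

(** For a prime factor r of k0, c must avoid the class 0 and, when r does not
    divide g, the one class with a + g c = 0 modulo r. Taking c = 1 modulo r
    works unless r divides a + g, and then c = -1 works: otherwise r would
    divide 2 a, so r = 2, which is excluded by the parity condition. The two
    cases are glued by the Chinese remainder theorem. *)
Lemma coprime_shift (a : int) (g k0 : nat) :
  0 < k0 -> coprimez a (Posz k0) -> `|a|%N < g -> odd k0 || ~~ odd g ->
  exists c : nat, coprime c k0 /\ coprimez (a + g%:Z * c%:Z)%R (Posz k0).
Proof.
move=> k0_gt0 ak0 ag par.
set w := `|(a + g%:Z)%R|%N.
have w0 : 0 < w by rewrite /w; lia.
set k1 := k0`_(\pi(w)); set k2 := k0`_(\pi(w)^').
have k12 : k1 * k2 = k0 by rewrite partnC.
have co12 : coprime k1 k2 by rewrite coprime_partC.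
pose c := chinese k1 k2 k1.-1 1.
have k1_gt0 : 0 < k1 by rewrite part_gt0.
have c1 : k1 %| c + 1.
  by rewrite /dvdn -modnDml chinese_modl // modnDml addn1 prednK // modnn.
have c2 : (Posz k2 %| (c%:Z - 1)%R)%Z.
  by rewrite -eqz_mod_dvd; apply/eqP; rewrite !modz_nat chinese_modr.
have test r : prime r -> r %| k0 -> ~~ (r %| c) /\ ~~ (Posz r %| (a + g%:Z * c%:Z)%R)%Z.
  move=> r_pr rk0.
  have ra : ~~ (Posz r %| a)%Z.
    apply/negP => ra; have : (Posz r %| gcdz a (Posz k0))%Z by rewrite dvdz_gcd ra dvdzE.
    by rewrite (eqP ak0) dvdzE /= dvdn1 => /eqP r1; rewrite r1 in r_pr.
  have r1 : ~~ (Posz r %| 1%R)%Z.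
    by rewrite dvdzE /= dvdn1; apply: contraTN r_pr => /eqP ->.
  move: (rk0); rewrite -k12 Euclid_dvdM // => /orP[rk1|rk2].
    have rc : (Posz r %| (c%:Z + 1)%R)%Z.
      by rewrite -PoszD dvdzE /= (dvdn_trans rk1).
    have rw : (Posz r %| (a + g%:Z)%R)%Z.
      have := pnatP _ k1_gt0 (part_pnat _ _) r r_pr rk1.
      by rewrite dvdzE mem_primes => /and3P[].
    split.
      apply: contra r1 => rc'.
      rewrite (_ : 1%R = ((c%:Z + 1) - c%:Z)%R); last by ring.
      by rewrite rpredB.
    apply/negP => rag.
    have r2a : (Posz r %| (2%:Z * a)%R)%Z.
      have -> : (2%:Z * a = (a + g%:Z * c%:Z) + (a + g%:Z) - g%:Z * (c%:Z + 1))%R by ring.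
      by apply: rpredB; [apply: rpredD | apply: dvdz_mull].
    move: r2a; rewrite dvdzE abszM Euclid_dvdM //= => /orP[r2|ra2]; last first.
      by move: ra; rewrite dvdzE /= ra2.
    have r2E : r = 2 by apply/eqP; rewrite -dvdn_prime2.
    subst r; move: rk0 par; rewrite dvdn2 => /negbTE -> /=; rewrite -dvdn2 => g2.
    move/negP: ra; apply.
    have -> : (a = (a + g%:Z) - g%:Z)%R by ring.
    by rewrite rpredB.
  have rc : (Posz r %| (c%:Z - 1)%R)%Z by apply: dvdz_trans c2; rewrite dvdzE.
  have rw : ~~ (Posz r %| (a + g%:Z)%R)%Z.
    have := pnatP _ (part_gt0 _ _) (part_pnat _ _) r r_pr rk2.
    by rewrite inE /= mem_primes r_pr w0 /= dvdzE.
  split.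
    apply: contra r1 => rc'.
    rewrite (_ : 1%R = (c%:Z - (c%:Z - 1))%R); last by ring.
    by rewrite rpredB.
  apply: contra rw => rw.
  have -> : (a + g%:Z = (a + g%:Z * c%:Z) - g%:Z * (c%:Z - 1))%R by ring.
  by apply: rpredB => //; apply: dvdz_mull.
exists c; split; first by apply: coprime_by_primes => // r rp /(test _ rp)[].
rewrite /coprimez /gcdz /=; apply/eqP; congr Posz; apply/eqP.
by apply: coprime_by_primes => // r rp /(test _ rp)[_]; rewrite dvdzE.
Qed.

(** The number a + m, as a natural number; it is only used when |a| < m. *)
Definition shift (a : int) (m : nat) : nat := `|(a + m%:Z)%R|%N.

Lemma shiftE (a : int) (m : nat) : `|a|%N < m -> Posz (shift a m) = (a + m%:Z)%R.
Proof. rewrite /shift; lia. Qed.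

(** The prime is taken in the class of a + g c modulo g k0, with c from
    [coprime_shift]. The cofactor j is congruent to c modulo k0 > 1, so it is
    not 0: the hypothesis alone could return the prime a itself. *)
Theorem shifted_prime B l0 : linnik_bound B l0 ->
  forall (a : int) (g k0 : nat), 1 < k0 -> coprimez a (Posz g) -> coprimez a (Posz k0) ->
  `|a|%N < g -> odd k0 || ~~ odd g -> l0 <= g * k0 ->
  exists j, [/\ 0 < j, coprime j k0, j <= k0 * lg (g * k0) ^ B & prime (shift a (g * j))].
Proof.
move=> hyp a g k0 k1 ag ak ltag par lel.
have k0_gt0 : 0 < k0 by apply: ltnW.
have g0 : 0 < g by apply: leq_ltn_trans ltag.
have [c [ck cb]] := coprime_shift k0_gt0 ak ltag par.
set b := (a + g%:Z * c%:Z)%R in cb.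
have cbg : coprimez b (Posz g).
  by rewrite /coprimez gcdzC /b mulrC addrC gcdzMDl gcdzC.
have bl : coprimez b (Posz (g * k0)) by rewrite PoszM coprimezMr cbg.
have [|p [p_pr pb ltp]] := hyp (g * k0) _ lel b bl; first by rewrite muln_gt0 g0.
move/eqP: pb; rewrite eqz_mod_dvd => /dvdzP[z zE].
have pE : (p%:Z - a = g%:Z * (c%:Z + z * k0%:Z))%R.
  have -> : (p%:Z - a = (p%:Z - b) + (b - a))%R by ring.
  by rewrite zE /b PoszM; ring.
set jz := (c%:Z + z * k0%:Z)%R in pE.
have j0 : (0 <= jz)%R.
  rewrite leNgt; apply/negP => jneg.
  have : (g%:Z * jz <= - g%:Z)%R by nia.
  rewrite -pE; lia.
have jE : jz = Posz `|jz|%N by lia.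
set j := `|jz|%N in jE.
have cj : coprime j k0.
  have : coprimez jz (Posz k0) by rewrite /jz /coprimez gcdzC addrC gcdzMDl gcdzC.
  by rewrite jE.
exists j; split=> //.
- rewrite lt0n; apply: contraL cj => /eqP ->.
  by rewrite /coprime gcd0n; lia.
- have h : (g%:Z * j%:Z < g%:Z * (k0 * lg (g * k0) ^ B)%N%:Z + g%:Z)%R.
    rewrite -jE -pE -PoszM mulnA; lia.
  have : (j%:Z < (k0 * lg (g * k0) ^ B)%N%:Z + 1)%R by nia.
  lia.
have -> : shift a (g * j) = p by rewrite /shift PoszM -jE -pE; lia.
by [].
Qed.

Lemma pigeonhole_count (T : eqType) (D : seq T) (Q : nat -> pred T) K c :
  0 < K -> {in D, forall d, exists2 k, k < K & Q k d} -> c * K <= size D ->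
  exists2 k, k < K & c <= count (Q k) D.
Proof.
move=> K0 QD cK.
case: (posnP c) => [->|c0]; first by exists 0.
suff /hasP[k] : has (fun k => c <= count (Q k) D) (iota 0 K).
  by rewrite mem_iota => /andP[_ kK] ck; exists k.
apply/negPn/negP => /hasPn no.
have: size D <= \sum_(k <- iota 0 K) count (Q k) D.
  elim: D QD {cK no} => [//|d D IHD] QD /=.
  rewrite big_split /= -add1n leq_add //; last first.
    by apply: IHD => e eD; apply: QD; rewrite inE eD orbT.
  have [k kK Qk] := QD _ (mem_head _ _).
  by rewrite (big_rem k) ?mem_iota //= Qk.
have: \sum_(k <- iota 0 K) count (Q k) D <= \sum_(k <- iota 0 K) c.-1.
  rewrite big_seq [X in _ <= X]big_seq; apply: leq_sum => k /no.
  by rewrite -ltnNge; lia.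
rewrite big_const_seq count_predT size_iota iter_addn addn0; nia.
Qed.

(** Each d has its own cofactor k at most K; pigeonhole retains a common one. *)
Theorem prime_pool B l0 : linnik_bound B l0 ->
  forall (a : int) (nu k0 K c : nat) (D : seq nat),
  1 < k0 -> coprimez a (Posz k0) -> odd k0 || ~~ odd nu ->
  {in D, forall d, [/\ coprimez a (Posz (nu * d)), `|a|%N < nu * d, l0 <= nu * d * k0 &
      k0 * lg (nu * d * k0) ^ B <= K]} ->
  0 < c -> c * K.+1 <= size D ->
  exists k, [/\ 0 < k, k <= K, coprime k k0 &
     c <= count (fun d => prime (shift a (nu * d * k))) D].
Proof.
move=> hyp a nu k0 K c D k1 ak par DP c0 cK.
pose Q k d := [&& 0 < k, coprime k k0 & prime (shift a (nu * d * k))].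
have [//||k kK ck] := @pigeonhole_count _ D Q K.+1 c _ _ cK.
  move=> d /DP[ad ltad ld Kd].
  have [|j [j0 cj jK pj]] := shifted_prime hyp k1 ad ak ltad _ ld.
    by rewrite oddM negb_and orbA par.
  by exists j; [rewrite ltnS (leq_trans jK)|rewrite /Q j0 cj].
have /hasP[d dD /and3P[k0' ck' _]] : has (Q k) D by rewrite has_count (leq_trans c0).
exists k; split=> //; apply: leq_trans ck _.
by apply: sub_count => e /and3P[].
Qed.

(** * Counting primes and products of primes *)

Definition primes_upto (n : nat) : seq nat := [seq p <- iota 0 n.+1 | prime p].

Lemma mem_primes_upto n p : (p \in primes_upto n) = prime p && (p <= n).
Proof. by rewrite mem_filter mem_iota leq0n add0n ltnS. Qed.

(** In Legendre's formula for (2n)! / n!^2 each power p ^ k contributes at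
    most 1, and nothing once p ^ k exceeds 2n. *)
Lemma logn_central_bin p n : prime p -> 0 < n -> p ^ logn p 'C(n.*2, n) <= n.*2.
Proof.
move=> p_pr n0; have p1 := prime_gt1 p_pr.
set T := trunc_log p n.*2.
have n20 : 0 < n.*2 by rewrite double_gt0.
apply: leq_trans (_ : p ^ T <= _); last exact: trunc_logP.
rewrite leq_exp2l //.
have C0 : 0 < 'C(n.*2, n) by rewrite bin_gt0 -addnn leq_addr.
have : logn p (n.*2)`! = logn p 'C(n.*2, n) + (logn p n`! + logn p n`!).
  rewrite -(bin_fact (_ : n <= n.*2)) -?addnn ?leq_addr // addnK.
  by rewrite !lognM ?muln_gt0 ?fact_gt0 // addnn C0.
rewrite !logn_fact // => e.
have nE : \sum_(1 <= k < n.+1) n %/ p ^ k = \sum_(1 <= k < n.*2.+1) n %/ p ^ k.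
  rewrite [RHS](big_cat_nat _ (n := n.+1)) //=; last by rewrite ltnS -addnn leq_addr.
  rewrite [X in _ + X]big_nat_cond [X in _ + X]big1 ?addn0 // => k /andP[/andP[nk _] _].
  by rewrite divn_small //; apply: ltn_trans (ltn_expl k p1).
have le : \sum_(1 <= k < n.*2.+1) n.*2 %/ p ^ k <=
    \sum_(1 <= k < n.*2.+1) (n %/ p ^ k + n %/ p ^ k + (k <= T)).
  rewrite big_nat_cond [X in _ <= X]big_nat_cond; apply: leq_sum => k _.
  have pk0 : 0 < p ^ k by rewrite expn_gt0 ltnW.
  case: (leqP k T) => kT.
    have := divn_eq n (p ^ k); have := ltn_pmod n pk0.
    set q := n %/ _; set r := n %% _ => rlt nEq.
    rewrite -ltnS ltn_divLR // -muln2; nia.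
  rewrite divn_small //; apply: leq_trans (trunc_log_ltn _ p1) _.
  by rewrite leq_exp2l.
move: le; rewrite e nE !big_split /= addnC leq_add2l.
move/leq_trans; apply.
case: (leqP T n.*2) => Tn.
  rewrite (big_cat_nat _ (n := T.+1)) //= [X in _ + X]big_nat_cond [X in _ + X]big1; last first.
    by move=> k /andP[/andP[Tk _] _]; rewrite leqNgt Tk.
  rewrite addn0; apply: leq_trans (_ : \sum_(1 <= k < T.+1) 1 <= _).
    by apply: leq_sum => k _; apply: leq_b1.
  by rewrite sum_nat_const_nat subSS subn0 muln1.
apply: leq_trans (_ : \sum_(1 <= k < n.*2.+1) 1 <= _).
  by apply: leq_sum => k _; apply: leq_b1.
by rewrite sum_nat_const_nat subSS subn0 muln1 ltnW.
Qed.

Lemma central_bin_ge n : 2 ^ n <= 'C(n.*2, n).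
Proof.
elim: n => [//|n IHn].
rewrite doubleS binS expnS mul2n -addnn leq_add //; apply: leq_trans IHn _.
  by rewrite binS leq_addl.
by case: n => // n; rewrite [X in _ <= X]binS leq_addr.
Qed.

Lemma prime_dvd_fact p n : prime p -> p %| n`! -> p <= n.
Proof.
move=> p_pr; elim: n => [|n IHn]; first by rewrite dvdn1 => /eqP p1; rewrite p1 in p_pr.
rewrite factS Euclid_dvdM // => /orP[/dvdn_leq-> //|/IHn]; exact: leqW.
Qed.

(** Chebyshev's argument: the central binomial coefficient of 2 ^ s is at
    least 2 ^ (2 ^ (s - 1)), and each prime contributes at most 2 ^ s to it. *)
Theorem chebyshev_pow2 s : 0 < s -> 2 ^ s.-1 <= s * size (primes_upto (2 ^ s)).
Proof.
case: s => // s _; rewrite succnK.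
have n0 : 0 < 2 ^ s by rewrite expn_gt0.
have n2 : (2 ^ s).*2 = 2 ^ s.+1 by rewrite -mul2n expnS.
set C := 'C((2 ^ s).*2, 2 ^ s).
have C0 : 0 < C by rewrite bin_gt0 -addnn leq_addr.
rewrite -(leq_exp2l _ _ (ltnSn 1)) expnM -n2.
apply: leq_trans (central_bin_ge _) _; rewrite -/C.
rewrite {1}(prod_prime_decomp C0) prime_decompE big_map /=.
apply: leq_trans (_ : \prod_(p <- primes C) (2 ^ s).*2 <= _).
  rewrite big_seq [X in _ <= X]big_seq; apply: leq_prod => p.
  by rewrite mem_primes => /and3P[p_pr _ _]; apply: logn_central_bin.
rewrite big_const_seq count_predT iter_muln_1 leq_pexp2l ?double_gt0 //.
apply: uniq_leq_size; first exact: primes_uniq.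
move=> p; rewrite mem_primes mem_primes_upto => /and3P[p_pr _ pC].
rewrite p_pr /= prime_dvd_fact // (dvdn_trans pC) //.
by rewrite -(bin_fact (_ : 2 ^ s <= (2 ^ s).*2)) ?dvdn_mulr // -addnn leq_addr.
Qed.

(** Each factor (n - i) / (u - i) of the binomial coefficient is at least n /
    u. *)
Lemma bin_lower n u : u <= n -> n ^ u <= 'C(n, u) * u ^ u.
Proof.
move=> un; rewrite -(leq_pmul2r (fact_gt0 u)) mulnAC bin_ffact.
rewrite ffact_prod -ffactnn ffact_prod.
rewrite -[X in n ^ X]card_ord -[X in u ^ X]card_ord -!prod_nat_const -!big_split /=.
by apply: leq_prod => i _; have := ltn_ord i; nia.
Qed.

(** The products are listed along Pascal's rule; they are distinct by unique
    factorization. *)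
Lemma subset_products (Q : seq nat) (u : nat) : uniq Q -> all prime Q ->
  exists D : seq nat, [/\ uniq D, size D = 'C(size Q, u) &
    {in D, forall d, [/\ d %| \prod_(q <- Q) q, 2 ^ u <= d &
      forall H, {in Q, forall q, q <= H} -> d <= H ^ u]}].
Proof.
elim: Q u => [|q Q IHQ] u /=.
  move=> _ _; case: u => [|u]; last by exists [::].
  by exists [:: 1]; split=> // d; rewrite inE => /eqP ->; split.
case: u => [_ _|u /andP[qQ uQ] /andP[q_pr Q_pr]].
  exists [:: 1]; split=> // d.
  by rewrite inE => /eqP ->; split=> //; rewrite dvd1n.
have [D1 [uD1 sD1 D1P]] := IHQ u.+1 uQ Q_pr.
have [D2 [uD2 sD2 D2P]] := IHQ u uQ Q_pr.
have q0 := prime_gt0 q_pr.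
have mulI : injective (muln q) by move=> x y /eqP; rewrite eqn_pmul2l // => /eqP.
have qnQ : ~~ (q %| \prod_(p <- Q) p).
  apply: contra qQ => qQ; rewrite -(mem_primes_prod Q_pr) mem_primes q_pr qQ.
  by rewrite prod_primes_gt0.
exists (D1 ++ map (muln q) D2); split.
- rewrite cat_uniq uD1 map_inj_uniq // uD2 andbT; apply/hasPn => _ /mapP[d _ ->].
  apply: contra qnQ => qd; have [dQ _ _] := D1P _ qd.
  by apply: dvdn_trans dQ; apply: dvdn_mulr.
- by rewrite size_cat size_map sD1 sD2 binS.
move=> d; rewrite mem_cat => /orP[/D1P[dQ d2 dH]|/mapP[e /D2P[eQ e2 eH] ->]].
  rewrite big_cons; split=> //; first by apply: dvdn_mull.
  by move=> H QH; apply: dH => p pQ; apply: QH; rewrite inE pQ orbT.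
rewrite big_cons; split; first by rewrite dvdn_pmul2l.
  by rewrite expnS leq_mul // prime_gt1.
move=> H QH; rewrite expnS leq_mul ?QH ?mem_head //.
by apply: eH => p pQ; apply: QH; rewrite inE pQ orbT.
Qed.

(** * Many primes q with q - 1 smooth *)

Lemma lg_gt0 n : 0 < lg n. Proof. by []. Qed.

Lemma eventually_lg C : exists s0, forall s, s0 <= s -> C * lg s <= s.
Proof.
have base : 4 * C + 1 <= 2 ^ (3 * C).
  rewrite expnM; elim: C => [//|C IH]; rewrite expnS.
  by move: IH; rewrite (_ : 2 ^ 3 = 8) //; move: (8 ^ C) => z; lia.
have lin i : C * (4 * C + i + 1) <= 2 ^ (4 * C + i).
  elim: i => [|i IHi].
    rewrite !addn0 (_ : 2 ^ (4 * C) = 2 ^ C * 2 ^ (3 * C)); last by rewrite -expnD; congr (_ ^ _); lia.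
    by rewrite leq_mul // ltnW // ltn_expl.
  rewrite [4 * C + i.+1]addnS expnS addSn mulnS mul2n -addnn leq_add //.
  by apply: leq_trans IHi; rewrite leq_pmulr //; lia.
exists (2 ^ (4 * C)) => s hs.
have s0 : 0 < s by apply: leq_trans hs; rewrite expn_gt0.
apply: leq_trans (trunc_logP (ltnSn 1) s0).
have h : 4 * C <= trunc_log 2 s by apply: trunc_log_max.
have := lin (trunc_log 2 s - 4 * C); rewrite subnKC //.
by rewrite addn1.
Qed.

Lemma eventually_pow C k : exists s0, forall s, s0 <= s -> C * s ^ k <= 2 ^ s.
Proof.
have [s0 h] := eventually_lg (lg C + k); exists s0 => s /h le.
apply: leq_trans (_ : 2 ^ lg C * (2 ^ lg s) ^ k <= _).
  apply: leq_mul; first exact: ltnW (ltn_lg C).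
  by case: k {h le} => // k; rewrite leq_exp2r // ltnW // ltn_lg.
rewrite -expnM -expnD leq_exp2l //; apply: leq_trans le.
by have := lg_gt0 s; nia.
Qed.

Lemma prod_primes_upto_dvd n : \prod_(p <- primes_upto n) p %| n`!.
Proof.
rewrite fact_prod big_filter /index_iota subSS subn0.
rewrite [X in _ %| X](bigID prime) /=; apply: dvdn_mulr.
by rewrite big_mkcond /= [X in _ %| X]big_mkcond /= big_cons /= mul1n.
Qed.

Lemma count_gt (Q : seq nat) b : uniq Q -> size Q <= count (fun q => b < q) Q + b.+1.
Proof.
move=> uQ; rewrite -(count_predC (fun q => b < q)) leq_add2l -size_filter -[X in _ <= X](size_iota 0 b.+1).
apply: uniq_leq_size; first exact: filter_uniq.
by move=> q; rewrite mem_filter mem_iota /= -leqNgt add0n ltnS => /andP[].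
Qed.

Lemma pow2_cancel a b C : b <= a -> 2 ^ a <= C * 2 ^ b -> 2 ^ (a - b) <= C.
Proof.
move=> ba h; rewrite -(leq_pmul2r (_ : 0 < 2 ^ b)) ?expn_gt0 //.
by rewrite -expnD subnK.
Qed.

(** The numbers m are the products of s distinct primes up to 2 ^ s, each of
    which divides (2 ^ s)!. There are at least (2 ^ s / (2 s ^ 2)) ^ s of them
    by [chebyshev_pow2] and [bin_lower], and [prime_pool] for the progression
    1 modulo m loses only a factor polynomial in s. The primes up to 2 ^ w,
    which are few, are discarded to make the cofactors of the later pools
    coprime to the remaining q. *)
Theorem smooth_primes B l0 s w : linnik_bound B l0 -> 0 < s -> l0 <= 2 ^ s ->
  s * s <= 2 ^ s.-1 ->
  let lam := lg s in
  w + (2 * lam * s + 2 * lam * B + 4) <= s * s.-1 ->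
  let e := s * s.-1 - (2 * lam * s + 2 * lam * B + 4) in
  exists k Q1 Q2, [/\ 0 < k /\ k < 2 ^ (2 * lam * B + 2), uniq (Q1 ++ Q2),
    size Q1 = 2 ^ e, size Q2 = 2 ^ e &
    {in Q1 ++ Q2, forall q, [/\ prime q, 2 ^ w < q, q <= 2 ^ (s * s + 2 * lam * B + 2) &
       q.-1 %| (2 ^ s)`! * k]}].
Proof.
move=> hyp s0 ls ss lam wle e.
have slam : s < 2 ^ lam by apply: ltn_lg.
set Pi := primes_upto (2 ^ s).
have Pi_u : uniq Pi by rewrite filter_uniq ?iota_uniq.
have Pi_pr : all prime Pi by apply/allP => p; rewrite mem_primes_upto => /andP[].
have cheb := chebyshev_pow2 s0.
have sPi : s <= size Pi by rewrite -(leq_pmul2l s0); apply: leq_trans cheb.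
have [D [uD sD DP]] := subset_products s Pi_u Pi_pr.
have DH d : d \in D -> d <= 2 ^ (s * s).
  move=> /DP[_ _ dH]; rewrite expnM; apply: dH => p.
  by rewrite mem_primes_upto => /andP[].
set K1 := 2 ^ (2 * lam * B + 2).
have K1_gt0 : 0 < K1 by rewrite expn_gt0.
have cardD : 2 ^ (s * s.-1 - 2 * lam * s) <= size D.
  rewrite sD; apply: pow2_cancel; first by lia.
  apply: leq_trans (_ : (s * size Pi) ^ s <= _).
    by rewrite mulnC expnM leq_exp2r.
  rewrite expnMn mulnC; apply: leq_trans (leq_mul (bin_lower sPi) (leqnn _)) _.
  rewrite -mulnA leq_mul2l -expnMn orbC; apply/orP; left.
  by rewrite expnM leq_exp2r // mul2n -addnn expnD leq_mul // ltnW.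
set e1 := e + 2.
have cle : 2 ^ e1 * K1.-1.+1 <= size D.
  rewrite prednK //; apply: leq_trans cardD; rewrite -expnD leq_exp2l // /e1 /e; lia.
(* With nu = 1 odd, k0 has to be odd and above 1; 3 is the least choice. *)
have [|||||k [k0 kK ck cnt]] := prime_pool hyp (a := 1%R) (nu := 1)
  (k0 := 3) (K := K1.-1) (c := 2 ^ e1) (D := D) _ _ _ _ _ cle.
- by [].
- by [].
- by [].
- move=> d dD; have [_ d2 _] := DP _ dD; have dle := DH _ dD.
  have d1 : 1 < d by apply: leq_trans d2; rewrite -(expn0 2) ltn_exp2l.
  rewrite mul1n; split=> //; first by rewrite /coprimez /gcdz /= gcd1n.
    by apply: leq_trans ls _; apply: leq_trans d2 _; rewrite leq_pmulr.
  rewrite -ltnS prednK // /K1 expnD mulnC.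
  apply: leq_ltn_trans (_ : 2 ^ (2 * lam * B) * 3 < _); last by rewrite ltn_pmul2l // expn_gt0.
  rewrite leq_mul2r /= expnM.
  have lgd : lg (d * 3) <= 2 ^ (2 * lam).
    apply: leq_trans (_ : s * s + 2 <= _).
      apply: lg_le; last by lia.
      rewrite expnD (_ : 2 ^ 2 = 4) //; have : 0 < 2 ^ (s * s) by rewrite expn_gt0.
      lia.
    by rewrite mulnC expnM expnS expn1; nia.
  by case: (B) => // B'; rewrite leq_exp2r.
- by rewrite expn_gt0.
have shE d : shift 1 (1 * d * k) = (d * k).+1 by rewrite /shift; lia.
pose Q0 := [seq (d * k).+1 | d <- D & prime (d * k).+1].
have Q0u : uniq Q0.
  rewrite map_inj_uniq ?filter_uniq // => x y [] /eqP.
  by rewrite eqn_pmul2r // => /eqP.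
have Q0s : 2 ^ e1 <= size Q0.
  rewrite size_map size_filter; apply: leq_trans cnt _; apply: eq_leq.
  by apply: eq_count => d; rewrite shE.
pose Q := [seq q <- Q0 | 2 ^ w < q].
have Qu : uniq Q by apply: filter_uniq.
have Qs : 2 ^ e + 2 ^ e <= size Q.
  rewrite size_filter; have := count_gt (2 ^ w) Q0u.
  have : 2 ^ w <= 2 ^ e by rewrite leq_exp2l // /e; lia.
  have : 0 < 2 ^ w by rewrite expn_gt0.
  move: Q0s; rewrite /e1 expnD (_ : 2 ^ 2 = 4) //.
  lia.
exists k, (take (2 ^ e) Q), (take (2 ^ e) (drop (2 ^ e) Q)).
have Qcat : take (2 ^ e) Q ++ take (2 ^ e) (drop (2 ^ e) Q) = take (2 ^ e + 2 ^ e) Q.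
  by rewrite takeD.
rewrite Qcat; split.
- by rewrite k0 (leq_ltn_trans kK) // prednK.
- exact: take_uniq.
- by rewrite size_takel //; apply: leq_trans Qs; apply: leq_addr.
- rewrite size_takel // size_drop leq_subRL //.
  by apply: leq_trans Qs; apply: leq_addr.
move=> q /mem_take; rewrite mem_filter => /andP[qw] /mapP[d].
rewrite mem_filter => /andP[dk dD] qE; move: qw; rewrite qE => qw.
have [dPi _ _] := DP _ dD; have dle := DH _ dD.
split=> //; last first.
  by rewrite /= dvdn_mul // (dvdn_trans dPi) // prod_primes_upto_dvd.
apply: leq_trans (_ : d * k.+1 <= _).
  rewrite mulnS addnC -addn1 leq_add2l.
  by have [_ d2 _] := DP _ dD; apply: leq_trans d2; rewrite expn_gt0.
rewrite -addnA expnD leq_mul // -/K1.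
by rewrite -(prednK K1_gt0) ltnS.
Qed.

(** * The modulus and the pools put together *)

Lemma eq1_mod_prod_primes (s : seq nat) (x : nat) : uniq s -> all prime s ->
  {in s, forall q, x = 1 %[mod q]} -> x = 1 %[mod \prod_(q <- s) q].
Proof.
elim: s => [|q s IHs]; first by rewrite big_nil !modn1.
move=> /= /andP[qs us] /andP[q_pr s_pr] xs; rewrite big_cons; apply/eqP.
rewrite chinese_remainder; last first.
  rewrite prime_coprime //; apply: contra qs => qs; rewrite -(mem_primes_prod s_pr).
  by rewrite mem_primes q_pr qs prod_primes_gt0.
rewrite (xs q (mem_head _ _)) eqxx IHs //= => p ps.
by apply: xs; rewrite inE ps orbT.
Qed.

Lemma mem_dvd_prod (s : seq nat) q : q \in s -> q %| \prod_(p <- s) p.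
Proof. by move=> qs; rewrite (perm_big _ (perm_to_rem qs)) big_cons dvdn_mulr. Qed.

Lemma exp_prod_primes (s : seq nat) (K x : nat) : uniq s -> all prime s ->
  {in s, forall q, q.-1 %| K} -> coprime x (\prod_(q <- s) q) ->
  x ^ K = 1 %[mod \prod_(q <- s) q].
Proof.
move=> us s_pr sK cx; apply: eq1_mod_prod_primes => // q qs.
have /dvdnP[z ->] := sK _ qs.
have q_pr := allP s_pr _ qs.
have cq : coprime x q by apply: coprime_dvdr cx; apply: mem_dvd_prod.
by rewrite mulnC expnM -totient_prime // -modnXm Euler_exp_totient // modnXm exp1n.
Qed.

(** The prime a + nu e k exceeds z, hence exceeds all the prime factors of M. *)
Lemma in_pool_shift (a : int) (nu k W M z x : nat) (Q D : seq nat) d :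
  all prime Q -> {in Q, forall q, q <= z} ->
  M = W * \prod_(q <- Q) q -> 0 < W ->
  {in D, forall e, [/\ z + `|a|%N < e, nu * e * k %| M & nu * e * k + `|a|%N <= x]} ->
  0 < nu -> 0 < k -> (forall p, prime p -> p %| W -> p <= z) ->
  d \in D -> prime (shift a (nu * d * k)) -> in_pool a nu M x (shift a (nu * d * k)).
Proof.
move=> Q_pr Qz ME W0 DP nu0 k0 Wz dD p_pr.
have [zd dM dx] := DP _ dD.
have dle : d <= nu * d * k by rewrite -mulnA mulnCA leq_pmulr // muln_gt0 nu0.
have lta : `|a|%N < nu * d * k by lia.
have pE := shiftE lta.
set p := shift a _ in p_pr pE *.
have pz : z < p by lia.
rewrite /in_pool p_pr /=; apply/and4P; split.
- rewrite prime_coprime // ME Euclid_dvdM // negb_or; apply/andP; split.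
    by apply/negP => /(Wz _ p_pr); rewrite leqNgt pz.
  apply/negP => pL; have : p \in Q.
    by rewrite -(mem_primes_prod Q_pr) mem_primes p_pr pL prod_primes_gt0.
  by move/Qz; rewrite leqNgt pz.
- by rewrite pE addrAC subrr add0r dvdzE.
- by rewrite pE addrAC subrr add0r dvdzE /= -mulnA dvdn_mulr.
- lia.
Qed.

(** M is a proper multiple of every nu d k. *)
Lemma shift_notin (a : int) (nu k Lk R M : nat) (D : seq nat) :
  Lk * k * R * nu = M -> 0 < M -> 1 < R -> {in D, forall d, d %| Lk} ->
  `|a|%N < M -> {in D, forall d, `|a|%N < nu * d * k} ->
  shift a M \notin [seq shift a (nu * d * k) | d <- D].
Proof.
move=> ME M0 R1 DL aM aD; apply/mapP => -[d dD /(congr1 Posz)].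
rewrite !shiftE ?aD // => /addrI [] MEd.
have Lk0 : 0 < Lk by move: M0; rewrite -ME !muln_gt0 => /andP[/andP[/andP[]]].
have dLk := dvdn_leq Lk0 (DL _ dD).
have : nu * d * k * R <= M.
  rewrite -ME (_ : Lk * k * R * nu = nu * Lk * k * R); last by ring.
  by rewrite !leq_mul2r leq_mul2l dLk !orbT.
by rewrite -MEd -[X in _ <= X]muln1 leq_pmul2l // leqNgt R1.
Qed.

(** The modulus is M = nu k1 k2 k3 L, with L the product of all the q and k3
    the cofactor of the last prime a + M. The exponent of (Z/M)^* is
    controlled by [exp_eq1_mul_modulus], since k3 may share factors with L.
    The bounds b and z separate the sizes: k1, k2 <= b < q <= z < d, so that
    the cofactors are coprime to L and the primes of the pools are coprime to
    M. *)
Theorem carmichael_assembly (a : int) (nu k1 k2 k3 K b z x m t X : nat) (Q1 Q2 D1 D2 : seq nat) :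
  0 < nu -> 0 < k1 -> 0 < k2 -> 0 < k3 -> 0 < K -> k1 <= b -> k2 <= b -> b <= z ->
  nu <= z -> k3 <= z -> coprime k2 k1 ->
  uniq (Q1 ++ Q2) -> 0 < size Q1 -> 0 < size Q2 ->
  {in Q1 ++ Q2, forall q, [/\ prime q, b < q, q <= z & q.-1 %| K]} ->
  uniq D1 -> uniq D2 ->
  {in D1, forall d, [/\ d %| \prod_(q <- Q1) q, z + `|a|%N < d, nu * d * k1 + `|a|%N <= x &
     prime (shift a (nu * d * k1))]} ->
  {in D2, forall d, [/\ d %| \prod_(q <- Q2) q, z + `|a|%N < d, nu * d * k2 + `|a|%N <= x &
     prime (shift a (nu * d * k2))]} ->
  let L := \prod_(q <- Q1 ++ Q2) q in
  let W := nu * k1 * k2 * k3 in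
  let M := W * L in
  prime (shift a M) -> `|a|%N < M -> M < 2 ^ m -> 0 < m ->
  let n := K * totient W * gcdn W L * m in
  n <= size D2 -> n <= t -> shift a M * (x ^ n * x ^ t) <= X ->
  'C(size D1, t) <= carmichael_ncount nu X a * (size D1).+1 ^ n.
Proof.
move=> nu0 k10 k20 k30 K0 k1b k2b bz nuz k3z ck uQ sQ1 sQ2 QP uD1 uD2 D1P D2P L W M ps_pr aM Mm m0 n nD2 nt leX.
have Q_pr : all prime (Q1 ++ Q2) by apply/allP => q /QP[].
move: (uQ) (Q_pr); rewrite cat_uniq all_cat => /and3P[uQ1 dQ uQ2] /andP[Q1_pr Q2_pr].
set L1 := \prod_(q <- Q1) q in D1P; set L2 := \prod_(q <- Q2) q in D2P.
have LE : L = L1 * L2 by rewrite /L big_cat.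
have L10 : 0 < L1 by apply: prod_primes_gt0.
have L20 : 0 < L2 by apply: prod_primes_gt0.
have gt1 (s : seq nat) : all prime s -> 0 < size s -> 1 < \prod_(q <- s) q.
  case: s => // q s /= /andP[q_pr s_pr] _; rewrite big_cons.
  apply: leq_trans (prime_gt1 q_pr) _; rewrite leq_pmulr //; exact: prod_primes_gt0.
have L11 : 1 < L1 by apply: gt1.
have L21 : 1 < L2 by apply: gt1.
have W0 : 0 < W by rewrite !muln_gt0 nu0 k10 k20.
have L0 : 0 < L by rewrite LE muln_gt0 L10.
have psE := shiftE aM; set ps := shift a M in ps_pr psE leX.
have cL12 : coprime L1 L2.
  apply: coprime_by_primes => // r r_pr rL2; apply: contra dQ => rL1.
  have rQ2 : r \in Q2 by rewrite -(mem_primes_prod Q2_pr) mem_primes r_pr L20.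
  have rQ1 : r \in Q1 by rewrite -(mem_primes_prod Q1_pr) mem_primes r_pr L10.
  by apply/hasP; exists r.
have ckL k : 0 < k -> k <= b -> coprime k L.
  move=> k0 kb; apply: coprime_by_primes => // r r_pr rL; apply/negP => rk.
  have rQ : r \in Q1 ++ Q2 by rewrite -(mem_primes_prod Q_pr) mem_primes r_pr L0.
  have [_ br _ _] := QP _ rQ.
  by have := leq_trans (dvdn_leq k0 rk) kb; rewrite leqNgt br.
have cDD d1 d2 : d1 \in D1 -> d2 \in D2 -> coprime (d1 * k1) (d2 * k2).
  move=> /D1P[d1L _ _ _] /D2P[d2L _ _ _].
  have := ckL _ k10 k1b; have := ckL _ k20 k2b; rewrite LE !coprimeMr => /andP[c21 _] /andP[_ c12].
rewrite !coprimeMl (coprime_dvdl d1L (coprime_dvdr d2L cL12)).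
  rewrite (coprime_dvdr d2L c12) [coprime k1 k2]coprime_sym ck andbT /= andbT.
  by rewrite coprime_sym (coprime_dvdr d1L c21).
have Wz p : prime p -> p %| W -> p <= z.
  move=> p_pr; rewrite /W !Euclid_dvdM // => /orP[/orP[/orP[]|]|] /dvdn_leq h.
  - exact: leq_trans (h nu0) nuz.
  - exact: leq_trans (h k10) (leq_trans k1b bz).
  - exact: leq_trans (h k20) (leq_trans k2b bz).
  - exact: leq_trans (h k30) k3z.
have Qz : {in Q1 ++ Q2, forall q, q <= z} by move=> q /QP[].
have D1M : {in D1, forall e, [/\ z + `|a|%N < e, nu * e * k1 %| M & nu * e * k1 + `|a|%N <= x]}.
  move=> d /D1P[dL zd dx _]; split=> //.
  rewrite /M /W LE (_ : nu * k1 * k2 * k3 * (L1 * L2) = nu * L1 * k1 * (k2 * k3 * L2)); last by ring.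
  by rewrite dvdn_mulr // !dvdn_mul.
have D2M : {in D2, forall e, [/\ z + `|a|%N < e, nu * e * k2 %| M & nu * e * k2 + `|a|%N <= x]}.
  move=> d /D2P[dL zd dx _]; split=> //.
  rewrite /M /W LE (_ : nu * k1 * k2 * k3 * (L1 * L2) = nu * L2 * k2 * (k1 * k3 * L1)); last by ring.
  by rewrite dvdn_mulr // !dvdn_mul.
have D1pr : {in D1, forall d, prime (shift a (nu * d * k1))} by move=> d /D1P[].
have D2pr : {in D2, forall d, prime (shift a (nu * d * k2))} by move=> d /D2P[].
have big (D : seq nat) k d : 0 < k ->
    {in D, forall e, [/\ z + `|a|%N < e, nu * e * k %| M & nu * e * k + `|a|%N <= x]} ->
    d \in D -> `|a|%N < nu * d * k.
  move=> k0 DP /DP[zd _ _].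
  have : d <= nu * d * k by rewrite -mulnA mulnCA leq_pmulr // muln_gt0 nu0.
  by move: zd; clear; lia.
have sh1 d : d \in D1 -> Posz (shift a (nu * d * k1)) = (a + (nu * d * k1)%N%:Z)%R.
  by move=> dD; apply: shiftE; apply: (big D1).
have sh2 d : d \in D2 -> Posz (shift a (nu * d * k2)) = (a + (nu * d * k2)%N%:Z)%R.
  by move=> dD; apply: shiftE; apply: (big D2).
pose P1 := [seq shift a (nu * d * k1) | d <- D1].
pose P2 := [seq shift a (nu * d * k2) | d <- D2].
have uP (D : seq nat) k : 0 < k -> uniq D ->
    {in D, forall d, Posz (shift a (nu * d * k)) = (a + (nu * d * k)%N%:Z)%R} ->
    uniq [seq shift a (nu * d * k) | d <- D].
  move=> k0 uD shD; rewrite map_inj_in_uniq // => d e dD eD /(congr1 Posz).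
  rewrite !shD // => /addrI [] /eqP.
  by rewrite eqn_pmul2r // eqn_pmul2l // => /eqP.
have D1big d : d \in D1 -> 1 < d.
  by move=> /D1P[_ zd _ _]; move: zd (leq_trans k10 (leq_trans k1b bz)); clear; lia.
have M1 : 1 < M.
  by apply: leq_trans L11 _; rewrite /M LE mulnCA leq_pmulr // muln_gt0 W0.
have P1pool : all (in_pool a nu M x) P1.
  apply/allP => _ /mapP[d dD ->].
  exact: (in_pool_shift Q_pr Qz (erefl M) W0 D1M nu0 k10 Wz dD (D1pr _ dD)).
have P2pool : all (in_pool a nu M x) P2.
  apply/allP => _ /mapP[d dD ->].
  exact: (in_pool_shift Q_pr Qz (erefl M) W0 D2M nu0 k20 Wz dD (D2pr _ dD)).
have E0 : 0 < K * totient W * gcdn W L.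
  by rewrite !muln_gt0 K0 totient_gt0 W0 gcdn_gt0 W0.
have expE y : coprime y M -> y ^ (K * totient W * gcdn W L) = 1 %[mod M].
  move=> cy; apply: exp_eq1_mul_modulus => //.
  apply: exp_prod_primes => // [q /QP[]//|].
  by apply: coprime_dvdr cy; rewrite /M dvdn_mull.
have := @carmichael_from_pools a nu M ps (K * totient W * gcdn W L) m t x X P1 P2
  M1 ps_pr psE (uP _ _ k10 uD1 sh1) (uP _ _ k20 uD2 sh2) P1pool P2pool.
rewrite -/n !size_map; apply; try assumption.
- apply: (@shift_notin _ _ _ L1 (k2 * k3 * L2)).
  + by rewrite /M /W LE; ring.
  + exact: ltnW.
  + by apply: leq_trans L21 _; rewrite leq_pmull // muln_gt0 k20.
  + by move=> d /D1P[].
  + exact: aM.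
  + by move=> d; apply: big D1M.
- apply: (@shift_notin _ _ _ L2 (k1 * k3 * L1)).
  + by rewrite /M /W LE; ring.
  + exact: ltnW.
  + by apply: leq_trans L11 _; rewrite leq_pmull // muln_gt0 k10.
  + by move=> d /D2P[].
  + exact: aM.
  + by move=> d; apply: big D2M.
- move=> _ _ /mapP[d1 d1D ->] /mapP[d2 d2D ->].
  rewrite sh1 // sh2 // ![(a + _)%R]addrC !addrK.
  rewrite /gcdz /= -!mulnA -muln_gcdr.
  by have /eqP-> := cDD _ _ d1D d2D; rewrite muln1.
- move=> _ /mapP[d1 d1D ->]; apply/mapP => -[d2 d2D /(congr1 Posz)].
  rewrite sh1 // sh2 // => /addrI [] /eqP.
  rewrite -!mulnA eqn_pmul2l // => /eqP e12.
  have := cDD _ _ d1D d2D; rewrite -e12 /coprime gcdnn => /eqP.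
  move/eqP; rewrite muln_eq1 => /andP[/eqP d11 _].
  by have := D1big _ d1D; rewrite d11.
- by rewrite dvdzE /= /M /W -!mulnA dvdn_mulr.
Qed.

(** * Choice of the parameters *)

Lemma prod_le_pow (s : seq nat) z : {in s, forall q, q <= z} -> \prod_(q <- s) q <= z ^ size s.
Proof.
elim: s => [|q s IHs] sz; first by rewrite big_nil.
rewrite big_cons expnS leq_mul ?sz ?mem_head // IHs // => p ps.
by apply: sz; rewrite inE ps orbT.
Qed.

Lemma fact_le_pow n : n`! <= n ^ n.
Proof.
rewrite fact_prod big_add1 /= big_mkord -[X in _ ^ X]card_ord -prod_nat_const.
by apply: leq_prod => i _.
Qed.

Lemma totient_le n : totient n <= n.
Proof.
rewrite totient_count_coprime -[X in _ <= X]subn0 -[X in _ <= X]muln1 -sum_nat_const_nat.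
by apply: leq_sum => i _; case: coprime.
Qed.

Lemma lt_mul_pow2 x y i j : x < 2 ^ i -> y <= 2 ^ j -> x * y < 2 ^ (i + j).
Proof.
move=> xi yj; rewrite expnD; apply: leq_ltn_trans (leq_mul (leqnn _) yj) _.
by rewrite ltn_pmul2r // expn_gt0.
Qed.

Lemma coprimez_nat (a : int) (k : nat) : coprimez a (Posz k) = coprime `|a|%N k.
Proof. by rewrite /coprimez /gcdz eqz_nat. Qed.

Lemma coprimez_prime (a : int) (q : nat) :
  a != 0%R -> prime q -> `|a|%N < q -> coprimez a (Posz q).
Proof.
move=> a0 q_pr aq; rewrite coprimez_nat coprime_sym prime_coprime //.
by apply/negP => /dvdn_leq; rewrite absz_gt0 a0 leqNgt aq => /(_ isT).
Qed.

(** A common divisor of a and k divides the prime a + m, and is at most |a|,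
    which is less than that prime. *)
Lemma coprimez_of_prime_shift (a : int) (k m : nat) :
  a != 0%R -> k %| m -> `|a|%N + `|a|%N < m -> prime (shift a m) -> coprimez a (Posz k).
Proof.
move=> a0 km am pm.
have pE : Posz (shift a m) = (a + m%:Z)%R by apply: shiftE; lia.
rewrite /coprimez /gcdz /=; apply/eqP; congr Posz.
set g := gcdn _ _.
have ga : g %| `|a|%N by apply: dvdn_gcdl.
have gp : g %| shift a m.
  suff : (Posz g %| Posz (shift a m))%Z by rewrite dvdzE.
  rewrite pE; apply: rpredD; first by rewrite dvdzE.
  by rewrite dvdzE /=; apply: dvdn_trans km; apply: dvdn_gcdr.
have gle : g <= `|a|%N by apply: dvdn_leq => //; lia.
move: (pm) => /primeP[_ /(_ _ gp)/orP[/eqP//|/eqP gE]]; lia.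
Qed.

(** The comparisons of binary exponents needed in [carmichael_count_at_scale].
    The margins come from s ^ 2 B being at most 2 ^ s / 64 and e at least 8 s
    B + 2 s + 2. *)
Lemma scale_exponents (B c0 s : nat) :
  0 < B -> c0 + 2 <= s -> 64 * B * s ^ 2 <= 2 ^ s ->
  let lam := lg s in
  8 * s * B + 2 * s + 2 + (2 * lam * s + 2 * lam * B + 4) <= s * s.-1 ->
  let h := s * s + 2 * lam * B + 2 in
  let e := s * s.-1 - (2 * lam * s + 2 * lam * B + 4) in
  let u := 2 ^ (2 * s) in
  let f := (e - 2 * s) * u in
  [/\ [/\ 2 <= s, c0 + 2 <= s * B, 2 * s <= e & s * s <= 2 ^ s.-1],
      [/\ h * u + c0 + 4 * s * B <= 2 ^ (3 * s),
         c0 + 12 * s * B + h * 2 ^ e.+1 <= 2 ^ (3 * (s * s)),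
         c0 + 3 * (s * s) * B <= 4 * (s * s) * B &
         2 ^ (3 * (s * s)) + 4 * (s * s) * B <= 2 ^ (4 * (s * s))],
      [/\ s * 2 ^ s + (2 * lam * B + 2) + (c0 + 12 * s * B + 4 * (s * s) * B) * 2 + 4 * (s * s)
           <= 2 * s * 2 ^ s,
         8 * (s * s) * B + 1 < u, h <= 8 * (s * s) * B & 4 * (s * s) + 1 <= 2 * s * 2 ^ s] &
      2 * s * 2 ^ s + 8 * s * B <= f /\ s * B <= s * s * B].
Proof.
move=> B0 c0s; rewrite expnS expn1; set Y := 2 ^ s => CY lam Ds h e u f.
have s2 : 2 <= s by apply: leq_trans c0s; rewrite leq_addl.
have uE : u = Y * Y by rewrite /u /Y -expnD addnn mul2n.
have e_ge : 8 * s * B + 2 * s + 2 <= e by rewrite /e; lia.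
have sB : s <= s * B by rewrite leq_pmulr.
have ss : s <= s * s by rewrite leq_pmulr //; lia.
have e_le : e <= s * s by rewrite /e (leq_trans (leq_subr _ _)) // leq_mul2l leq_pred orbT.
have hs : h <= 2 * (s * s).
  have : s * s.-1 <= s * s by rewrite leq_mul2l leq_pred orbT.
  rewrite /h; lia.
have ssB : s * s <= s * s * B by rewrite leq_pmulr.
have sBss : s * B <= s * s * B by rewrite leq_mul2r ss orbT.
have sY : s < Y by apply: ltn_expl.
move: CY; rewrite (_ : 64 * B * (s * s) = 64 * (s * s * B)); last by ring.
move=> CY.
have Y4 : 4 <= Y by rewrite -[4]/(2 ^ 2) leq_exp2l.
have lB : 2 * lam * B + 2 <= 2 * (s * s) by rewrite -/h; apply: leq_trans hs; rewrite /h -addnA leq_addl.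
have YsY : Y <= s * Y by rewrite leq_pmull //; lia.
have Yu : Y <= u by rewrite uE leq_pmulr //; lia.
clearbody e h lam; rewrite -!mulnA.
rewrite -!mulnA in Ds sBss ssB CY hs lB e_ge.
set sB' := s * B in sB sBss e_ge *; set q := s * s in ss e_le hs lB *.
set qB := s * (s * B) in sBss ssB CY *.
have lE : s * (s * B) = qB by [].
rewrite -/q in ssB.
have q2 : 2 <= q by apply: leq_trans ss.
split; [split|split|split|split] => //.
- lia.
- lia.
- have : Y = 2 * 2 ^ s.-1 by rewrite -expnS prednK //; lia.
  lia.
- have -> : 2 ^ (3 * s) = Y * u by rewrite /Y /u -expnD; congr (_ ^ _); lia.
  have h1 : h * u <= 2 * q * u by rewrite leq_mul2r hs orbT.
  have h2 : 64 * qB * u <= Y * u by rewrite leq_mul2r CY orbT.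
  have h3 : qB <= qB * u by rewrite leq_pmulr // expn_gt0.
  have h4 : q * u <= qB * u by rewrite leq_mul2r ssB orbT.
  clear -h1 h2 h3 h4 c0s sBss ss ssB; lia.
- have h1 : h * 2 ^ e.+1 <= 2 ^ (s + q.+1).
    rewrite expnD -/Y; apply: leq_mul; first by clear -hs ssB CY; lia.
    by rewrite leq_exp2l // ltnS.
  have h2 : Y <= 2 ^ (s + q.+1) by rewrite /Y leq_exp2l // leq_addr.
  apply: leq_trans (_ : 2 ^ (s + q.+1).+1 <= _).
    rewrite [X in _ <= X]expnS; clear -h1 h2 c0s ss ssB sBss CY; lia.
  rewrite leq_exp2l //; lia.
- lia.
- have h2 : Y <= 2 ^ (3 * q) by rewrite /Y leq_exp2l //; clear -ss; lia.
  apply: leq_trans (_ : 2 ^ (3 * q).+1 <= _).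
    rewrite [X in _ <= X]expnS; clear -h2 CY; lia.
  rewrite leq_exp2l //; lia.
- clear -lB c0s ss ssB sBss CY YsY; lia.
- clear -q2 ssB CY Yu; lia.
- lia.
- clear -q2 ssB CY YsY; lia.
- have h1 : (8 * sB' + 2) * u <= f by rewrite leq_mul2r; apply/orP; right; lia.
  have h2 : sB' <= sB' * u by rewrite leq_pmulr // expn_gt0.
  have h3 : s * Y <= u by rewrite uE leq_mul2r ltnW ?orbT.
  clear -h1 h2 h3; lia.
Qed.

(** The parameters, in terms of Y = 2 ^ s: 2 ^ e primes q of size at most 2 ^
    h in each half; u = Y ^ 2 of them in each d; cofactors k1 < 2 ^ (4 s B),
    k2 < 2 ^ (8 s B), k3 <= 2 ^ (4 s ^ 2 B); pool primes at most 2 ^ xi; N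
    pool primes kept; and n = 2 ^ (2 s Y) bounds E m, the number of elements
    that forces a product-one subset. The auxiliary prime r > |a| is a modulus
    for the cofactors, which makes them nonzero; it has to be odd for the
    parity condition of [shifted_prime]. *)
Theorem carmichael_count_at_scale (B l0 : nat) (a : int) (nu r c0 s : nat) :
  linnik_bound B l0 -> 0 < B -> a != 0%R -> 0 < nu -> coprimez a (Posz nu) ->
  odd `|a|%N != odd nu -> prime r -> `|a|%N < r -> odd r -> nu * r < 2 ^ c0 ->
  c0 + 2 <= s -> l0 <= 2 ^ s -> 64 * B * s ^ 2 <= 2 ^ s ->
  let lam := lg s in
  8 * s * B + 2 * s + 2 + (2 * lam * s + 2 * lam * B + 4) <= s * s.-1 ->
  let h := s * s + 2 * lam * B + 2 in
  let e := s * s.-1 - (2 * lam * s + 2 * lam * B + 4) in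
  let u := 2 ^ (2 * s) in
  let f := (e - 2 * s) * u in
  let n := 2 ^ (2 * s * 2 ^ s) in
  let N := 2 ^ (f - 4 * s * B) in
  let xi := h * u + 9 * s * B in
  forall t X, n <= t -> 2 ^ (xi * (2 * n + t)) <= X ->
  'C(N, t) <= carmichael_ncount nu X a * N.+1 ^ n.
Proof.
move=> hyp B0 a0 nu0 anu par r_pr ra rodd nurc0 c0s l0s Cs lam Ds h e u f n N xi t X nt leX.
have r0 : 0 < r := prime_gt0 r_pr.
have [[s2 c0sB es ss2] [F1 F3 F4 F5] [F6 F7 F8 F9] [F10 F11]] := scale_exponents B0 c0s Cs Ds.
rewrite -/lam -/h in F1 F3 F8; rewrite -/e in es F1 F3; rewrite -/u in F1 F7.
rewrite -/lam in F6; rewrite -/e -/u -/f in F10.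
have rc0 : r < 2 ^ c0 by apply: leq_ltn_trans nurc0; rewrite leq_pmull.
have nuc0 : nu < 2 ^ c0 by apply: leq_ltn_trans nurc0; rewrite leq_pmulr.
have ac0 : `|a|%N < 2 ^ c0 by apply: ltn_trans rc0.
have s0 : 0 < s by apply: ltnW.
have [|k [Q1 [Q2 [[k0 kK] uQ sQ1 sQ2 QP]]]] := @smooth_primes B l0 s (8 * s * B) hyp s0 l0s ss2.
  by apply: leq_trans Ds; rewrite leq_add2r -addnA leq_addr.
rewrite -/lam -/e in sQ1 sQ2; rewrite -/lam -/h in kK QP.
set b := 2 ^ (8 * s * B) in QP; set z := 2 ^ (8 * (s * s) * B).
have bz : b <= z.
  by rewrite leq_exp2l // -mulnA -[X in _ <= X]mulnA leq_mul2l F11.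
have pow_gt (y : nat) : 0 < 2 ^ y by rewrite expn_gt0.
have ab : `|a|%N <= b.
  apply: leq_trans (ltnW ac0) _; rewrite leq_exp2l //; clear -c0sB; lia.
have Q_pr : all prime (Q1 ++ Q2) by apply/allP => q /QP[].
move: (uQ) (Q_pr); rewrite cat_uniq all_cat => /and3P[uQ1 _ uQ2] /andP[Q1_pr Q2_pr].
have aq : {in Q1 ++ Q2, forall q, coprimez a (Posz q)}.
  by move=> q /QP[q_pr bq _ _]; apply: coprimez_prime => //; apply: leq_ltn_trans bq.
have coprod (Q : seq nat) : {subset Q <= Q1 ++ Q2} -> coprimez a (Posz (\prod_(q <- Q) q)).
  elim: Q => [|q Q IHQ] sub; first by rewrite big_nil coprimez_nat coprimen1.
  rewrite big_cons PoszM coprimezMr aq ?sub ?mem_head //= IHQ // => p pQ.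
  by apply: sub; rewrite inE pQ orbT.
have codvd (m m' : nat) : coprimez a (Posz m') -> m %| m' -> coprimez a (Posz m).
  by rewrite !coprimez_nat => am' mm'; apply: coprime_dvdr am'.
have ar : coprimez a (Posz r) by apply: coprimez_prime.
have getD (Q : seq nat) : uniq Q -> all prime Q -> {subset Q <= Q1 ++ Q2} -> size Q = 2 ^ e ->
  exists D : seq nat, [/\ uniq D, 2 ^ f <= size D &
    {in D, forall d, [/\ d %| \prod_(q <- Q) q, 2 ^ u <= d, d <= 2 ^ (h * u) & coprimez a (Posz (nu * d))]}].
  move=> uQ' Qpr' sub sQ; have [D [uD sD DP]] := subset_products u uQ' Qpr'.
  exists D; split=> //.
    rewrite sD sQ /f mulnBl; apply: pow2_cancel; first by rewrite leq_mul2r es orbT.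
    rewrite expnM (expnM _ (2 * s)); apply: bin_lower.
    by rewrite /u leq_exp2l.
  move=> d /DP[dQ du dH]; split=> //.
    by rewrite expnM; apply: dH => q /sub/QP[].
  by rewrite PoszM coprimezMr anu (codvd _ _ (coprod _ sub)).
have sub1 : {subset Q1 <= Q1 ++ Q2} by move=> q; rewrite mem_cat => ->.
have sub2 : {subset Q2 <= Q1 ++ Q2} by move=> q; rewrite mem_cat orbC => ->.
have [D1 [uD1 sD1 D1P]] := getD _ uQ1 Q1_pr sub1 sQ1.
have [D2 [uD2 sD2 D2P]] := getD _ uQ2 Q2_pr sub2 sQ2.
have zd d : 2 ^ u <= d -> z + `|a|%N < d.
  apply: leq_trans; apply: leq_trans (_ : 2 ^ (8 * (s * s) * B + 1).+1 <= _).
    rewrite expnS addn1 expnS -/z; move: ab bz (pow_gt (8 * (s * s) * B)); rewrite -/z.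
    by clear; lia.
  by rewrite leq_exp2l.
have lgb d kk : d <= 2 ^ (h * u) -> kk <= 2 ^ (4 * s * B) -> lg (nu * d * (r * kk)) ^ B <= 2 ^ (3 * s * B).
  move=> dle kle; rewrite (expnM _ (3 * s)).
  suff le : lg (nu * d * (r * kk)) <= 2 ^ (3 * s) by case: (B) => // B'; rewrite leq_exp2r.
  apply: lg_le => //; rewrite mulnACA.
  have dk : d * kk <= 2 ^ (h * u + 4 * s * B) by rewrite expnD leq_mul.
  apply: leq_trans (lt_mul_pow2 nurc0 dk) _.
  rewrite leq_exp2l //; clear -F1; lia.
(* Both pools come from this claim, with kk = 1 for the first one and kk = k1
   for the second one, to make k2 coprime to k1.  When nu is odd, a is
   even by the parity hypothesis, so that kk, being coprime to a, is odd. *)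
have pool (D : seq nat) kk j : {in D, forall d, [/\ 2 ^ u <= d, d <= 2 ^ (h * u) & coprimez a (Posz (nu * d))]} ->
    0 < kk -> kk <= 2 ^ (4 * s * B) -> coprimez a (Posz kk) -> r * kk * 2 ^ (3 * s * B) < 2 ^ j -> j <= f ->
    2 ^ f <= size D ->
    exists k, [/\ 0 < k, k < 2 ^ j, coprime k (r * kk) &
      2 ^ (f - j) <= count (fun d => prime (shift a (nu * d * k))) D].
  move=> DP kk0 kk4 akk jlt jf fD.
  have [||||||k' [k'0 k'K k'c cnt]] := @prime_pool B l0 hyp a nu (r * kk) (2 ^ j).-1 (2 ^ (f - j)) D.
  - by apply: leq_trans (prime_gt1 r_pr) _; rewrite leq_pmulr.
  - by rewrite PoszM coprimezMr ar.
  - rewrite oddM rodd /=; case: (boolP (odd kk)) => //= kke.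
    apply: contraNN par => nuo; rewrite nuo eqb_id.
    apply: contraTT akk => ae; rewrite coprimez_nat; apply/negP => c2.
    have : 2 %| gcdn `|a|%N kk by rewrite dvdn_gcd !dvdn2 ae kke.
    by rewrite (eqP c2).
  - move=> d /DP[d1 d2 d3]; split=> //.
    + by have := zd _ d1; have : d <= nu * d by [rewrite leq_pmull]; clear; lia.
    + apply: leq_trans l0s _; apply: leq_trans (_ : d <= _); last first.
        by rewrite mulnAC leq_pmull // !muln_gt0 nu0 r0.
      apply: leq_trans d1; rewrite leq_exp2l //; clear -F7 F11 s2 B0.
      have : s * 1 <= s * B by rewrite leq_mul2l B0 orbT.
      lia.
    rewrite -ltnS prednK //; apply: leq_ltn_trans jlt.
    by rewrite leq_mul2l lgb ?orbT.
  - exact: pow_gt.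
  - by rewrite prednK // -expnD subnK.
  by exists k'; split=> //; move: k'K; rewrite -ltnS prednK.
have F10' : 8 * s * B <= f by apply: leq_trans F10; rewrite leq_addl.
have D1Q : {in D1, forall d, [/\ 2 ^ u <= d, d <= 2 ^ (h * u) & coprimez a (Posz (nu * d))]} by move=> d /D1P[].
have D2Q : {in D2, forall d, [/\ 2 ^ u <= d, d <= 2 ^ (h * u) & coprimez a (Posz (nu * d))]} by move=> d /D2P[].
have [||||k1 [k10 k14 k1c cnt1]] := pool D1 1 (4 * s * B) D1Q (ltnSn 0) _ _ _ _ sD1.
- exact: pow_gt.
- by rewrite coprimez_nat coprimen1.
- rewrite muln1; apply: leq_trans (lt_mul_pow2 rc0 (leqnn _)) _.
  rewrite leq_exp2l //; clear -c0sB; lia.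
- by apply: leq_trans F10'; rewrite !leq_mul2r !orbT.
have cN1 : 0 < count (fun d => prime (shift a (nu * d * k1))) D1 by apply: leq_trans cnt1; apply: pow_gt.
have ak1 : coprimez a (Posz k1).
  move: cN1; rewrite -has_count => /hasP[d dD dpr].
  have [du _ _] := D1Q _ dD; have zd' := zd _ du.
  apply: coprimez_of_prime_shift dpr => //; first exact: dvdn_mull.
  apply: leq_trans (_ : d <= _); first by move: zd' bz ab; clear; lia.
  by rewrite mulnAC leq_pmull // muln_gt0 nu0.
have [||||k2 [k20 k28 k2c cnt2]] := pool D2 k1 (8 * s * B) D2Q k10 _ _ _ _ sD2.
- exact: ltnW.
- exact: ak1.
- apply: leq_ltn_trans (_ : r * (2 ^ (4 * s * B) * 2 ^ (3 * s * B)) < _).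
    by rewrite -mulnA leq_mul2l leq_mul2r (ltnW k14) !orbT.
  rewrite -expnD; apply: leq_trans (lt_mul_pow2 rc0 (leqnn _)) _.
  rewrite leq_exp2l //; clear -c0sB; lia.
- exact: F10'.
set L := \prod_(q <- Q1 ++ Q2) q.
have L0 : 0 < L by apply: prod_primes_gt0.
have sQ1' : 0 < size Q1 by rewrite sQ1.
have sQ2' : 0 < size Q2 by rewrite sQ2.
have bL : b < L.
  have q1 : nth 0 Q1 0 \in Q1 ++ Q2 by rewrite mem_cat mem_nth.
  have [_ bq _ _] := QP _ q1.
  by apply: leq_trans bq _; apply: dvdn_leq => //; apply: mem_dvd_prod.
have Lle : L <= 2 ^ (h * 2 ^ e.+1).
  have : L <= (2 ^ h) ^ size (Q1 ++ Q2) by apply: prod_le_pow => q /QP[].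
  by rewrite size_cat sQ1 sQ2 addnn -mul2n -expnS -expnM.
have k124 : k1 * k2 * L <= 2 ^ (12 * s * B + h * 2 ^ e.+1).
  rewrite expnD leq_mul // (_ : 12 * s * B = 4 * s * B + 8 * s * B); last by ring.
  by rewrite expnD leq_mul // ltnW.
pose g := nu * k1 * k2 * L.
have g0 : 0 < g by rewrite !muln_gt0 nu0 k10 k20.
have Lg : L <= g by rewrite leq_pmull // !muln_gt0 nu0 k10.
have ak2 : coprimez a (Posz k2).
  have cN2 : 0 < count (fun d => prime (shift a (nu * d * k2))) D2 by apply: leq_trans cnt2; apply: pow_gt.
  move: cN2; rewrite -has_count => /hasP[d dD dpr].
  have [du _ _] := D2Q _ dD; have zd' := zd _ du.
  apply: coprimez_of_prime_shift dpr => //; first exact: dvdn_mull.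
  apply: leq_trans (_ : d <= _); first by move: zd' bz ab; clear; lia.
  by rewrite mulnAC leq_pmull // muln_gt0 nu0.
have ag : coprimez a (Posz g).
  by rewrite !PoszM !coprimezMr anu ak1 ak2 coprod.
have ltag : `|a|%N < g by apply: leq_ltn_trans ab _; apply: leq_trans bL Lg.
have grlt : g * r < 2 ^ (2 ^ (3 * (s * s))).
  rewrite (_ : g * r = nu * r * (k1 * k2 * L)); last by rewrite /g; ring.
  apply: leq_trans (lt_mul_pow2 nurc0 k124) _.
  rewrite leq_exp2l //; clear -F3; lia.
have l0gr : l0 <= g * r.
  apply: leq_trans l0s _; apply: leq_trans (_ : b <= _).
    rewrite leq_exp2l //; clear -c0sB s0 B0.
    have : s * 1 <= s * B by rewrite leq_mul2l B0 orbT.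
    lia.
  by apply: leq_trans (ltnW bL) _; apply: leq_trans Lg _; rewrite leq_pmulr.
have [|k3 [k30 k3c k3le psp]] := shifted_prime hyp (prime_gt1 r_pr) ag ar ltag _ l0gr.
  by rewrite rodd.
have k3lt : k3 <= 2 ^ (4 * (s * s) * B).
  apply: leq_trans k3le _; apply: leq_trans (_ : 2 ^ c0 * 2 ^ (3 * (s * s) * B) <= _); last first.
    by rewrite -expnD leq_exp2l.
  apply: leq_mul; first exact: ltnW.
  rewrite (expnM _ (3 * (s * s))).
  suff le : lg (g * r) <= 2 ^ (3 * (s * s)) by case: (B) => // B'; rewrite leq_exp2r.
  exact: lg_le.
pose W := nu * k1 * k2 * k3.
have WL : W * L = g * k3 by rewrite /W /g; ring.
have MltM : W * L < 2 ^ (2 ^ (4 * (s * s))).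
  rewrite WL; apply: leq_ltn_trans (_ : g * r * k3 < _).
    by rewrite leq_mul2r leq_pmulr ?orbT.
  by apply: leq_trans (lt_mul_pow2 grlt k3lt) _; rewrite leq_exp2l.
have Wle : W <= 2 ^ (c0 + 12 * s * B + 4 * (s * s) * B).
  rewrite expnD leq_mul // /W -mulnA expnD leq_mul //; first exact: ltnW.
  rewrite (_ : 12 * s * B = 4 * s * B + 8 * s * B); last by ring.
  by rewrite expnD leq_mul // ltnW.
have W0 : 0 < W by rewrite !muln_gt0 nu0 k10 k20.
set m := 2 ^ (4 * (s * s)) in MltM.
set K := (2 ^ s)`! * k in QP.
have K0 : 0 < K by rewrite muln_gt0 fact_gt0.
have Kle : K <= 2 ^ (s * 2 ^ s + (2 * lam * B + 2)).
  rewrite expnD leq_mul //; last exact: ltnW.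
  by rewrite (expnM _ s); apply: fact_le_pow.
pose n' := K * totient W * gcdn W L * m.
have n'n : n' <= n.
  apply: leq_trans (_ : 2 ^ (s * 2 ^ s + (2 * lam * B + 2) +
    (c0 + 12 * s * B + 4 * (s * s) * B) * 2 + 4 * (s * s)) <= _); last by rewrite leq_exp2l.
  rewrite expnD leq_mul // expnD -mulnA leq_mul // expnM expnS expn1 leq_mul //.
    exact: leq_trans (totient_le W) Wle.
  by apply: leq_trans Wle; apply: dvdn_leq => //; apply: dvdn_gcdl.
pose D1' := take N [seq d <- D1 | prime (shift a (nu * d * k1))].
pose D2' := [seq d <- D2 | prime (shift a (nu * d * k2))].
have sD1' : size D1' = N by rewrite size_takel // size_filter.
have nD2' : n' <= size D2'.
  apply: leq_trans n'n _; rewrite size_filter; apply: leq_trans cnt2.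
  by rewrite leq_exp2l //; clear -F10; lia.
have xle d kk : d <= 2 ^ (h * u) -> kk < 2 ^ (8 * s * B) -> nu * d * kk + `|a|%N <= 2 ^ xi.
  move=> dle kle; have dk : d * kk <= 2 ^ (h * u + 8 * s * B) by rewrite expnD leq_mul // ltnW.
  have lt1 := lt_mul_pow2 nuc0 dk.
  apply: leq_trans (_ : 2 ^ (c0 + (h * u + 8 * s * B)).+1 <= _).
    have lt2 : `|a|%N < 2 ^ (c0 + (h * u + 8 * s * B)).
      by apply: leq_trans ac0 _; rewrite leq_exp2l // leq_addr.
    by rewrite -mulnA [X in _ <= X]expnS mul2n -addnn leq_add // ltnW.
  rewrite leq_exp2l // /xi; clear -c0sB; lia.
have QPz : {in Q1 ++ Q2, forall q, [/\ prime q, b < q, q <= z & q.-1 %| K]}.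
  move=> q /QP[? ? qh ?]; split=> //; apply: leq_trans qh _.
  by rewrite leq_exp2l.
have k1b : k1 <= b.
  by apply: leq_trans (ltnW k14) _; rewrite leq_exp2l // !leq_mul2r !orbT.
have c0z : 2 ^ c0 <= z by apply: leq_trans bz; rewrite leq_exp2l //; clear -c0sB; lia.
have psW : prime (shift a (W * L)) by rewrite WL.
have aW : `|a|%N < W * L by rewrite WL; apply: leq_trans ltag _; rewrite leq_pmulr.
have ck21 : coprime k2 k1 by move: k2c; rewrite coprimeMr => /andP[].
have cm : c0 <= m.
  apply: leq_trans (ltnW (ltn_expl _ (ltnSn 1))) _; rewrite leq_exp2l //.
  move: c0s s2; clear; nia.
have xi0 : 0 < xi by rewrite /xi addn_gt0 !muln_gt0 s0 B0 orbT.
have Xle : shift a (W * L) * ((2 ^ xi) ^ n' * (2 ^ xi) ^ t) <= X.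
  apply: leq_trans leX.
  rewrite (_ : xi * (2 * n + t) = xi * n + (xi * n + xi * t)); last by ring.
  rewrite 2!(expnD 2 (xi * n)) !(expnM 2 xi).
  apply: leq_mul; last by apply: leq_mul => //; rewrite leq_pexp2l.
  apply: leq_trans (_ : W * L + `|a|%N <= _); first by rewrite /shift; clear; lia.
  apply: leq_trans (_ : 2 ^ m.+1 <= _).
    have am : `|a|%N <= 2 ^ m.
      by apply: leq_trans (ltnW ac0) _; rewrite leq_exp2l //; apply: leq_trans cm.
    by rewrite expnS mul2n -addnn leq_add // ltnW.
  rewrite -expnM leq_exp2l //; apply: leq_trans (_ : n <= _); last by rewrite leq_pmull.
  apply: leq_trans (_ : 2 ^ (4 * (s * s) + 1) <= _); last by rewrite leq_exp2l.
  by rewrite addn1 [X in _ <= X]expnS mul2n -addnn -addn1 leq_add // pow_gt.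
have k3z : k3 <= z.
  apply: leq_trans k3lt _; rewrite leq_exp2l // !leq_mul2r; clear; lia.
have uD1' : uniq D1' by rewrite take_uniq // filter_uniq.
have uD2' : uniq D2' by rewrite filter_uniq.
have D1'P : {in D1', forall d, [/\ d %| \prod_(q <- Q1) q, z + `|a|%N < d,
    nu * d * k1 + `|a|%N <= 2 ^ xi & prime (shift a (nu * d * k1))]}.
  move=> d /mem_take; rewrite mem_filter => /andP[dpr dD].
  have [dQ du dh _] := D1P _ dD; split=> //; first exact: zd.
  by apply: xle => //; apply: leq_trans k14 _; rewrite leq_exp2l // !leq_mul2r !orbT.
have D2'P : {in D2', forall d, [/\ d %| \prod_(q <- Q2) q, z + `|a|%N < d,
    nu * d * k2 + `|a|%N <= 2 ^ xi & prime (shift a (nu * d * k2))]}.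
  move=> d; rewrite mem_filter => /andP[dpr dD].
  by have [dQ du dh _] := D2P _ dD; split=> //; [exact: zd|exact: xle].
have := @carmichael_assembly a nu k1 k2 k3 K b z (2 ^ xi) m t X Q1 Q2 D1' D2'
   nu0 k10 k20 k30 K0 k1b (ltnW k28) bz (leq_trans (ltnW nuc0) c0z) k3z ck21
   uQ sQ1' sQ2' QPz uD1' uD2' D1'P D2'P psW aW MltM
   (pow_gt _) nD2' (leq_trans n'n nt) Xle.
rewrite sD1' => /leq_trans; apply; rewrite leq_mul2l; apply/orP; right.
by rewrite leq_pexp2l.
Qed.

(** * The count as a power of X *)

(** For X of about 2 ^ J this says that cnt X is at least X ^ (1 - (2 lg s +
    C) / s), with denominators cleared. The window for s makes s 2 ^ s
    comparable to log log X, and the windows of consecutive s cover all J. *)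
Definition log_dense (cnt : nat -> nat) : Prop :=
  exists C s0, forall s, s0 <= s -> forall J,
    7 * s * 2 ^ s <= lg J -> lg J < 7 * s.+1 * 2 ^ s.+1 ->
    forall X, 2 ^ J <= X -> 2 ^ (J * s) <= cnt X ^ s * 2 ^ (J * (2 * lg s + C)).

(** The main term: per prime of the product, xi - nu is the gap between the
    logarithms of the size and of the number of the primes in the pool, and
    tau bounds log t. Relative to xi >= s ^ 2 u the gap is (2 lam + O(1)) / s;
    the remaining terms amount to at most J in total. *)
Lemma exponent_budget (B s lam h e u f n nu xi t J tau : nat) :
  0 < s -> lam <= s -> h = s * s + 2 * lam * B + 2 ->
  2 * s <= e -> e + (2 * lam * s + 2 * lam * B + 4) = s * s.-1 ->
  f = (e - 2 * s) * u -> 4 * s * B <= f -> nu = f - 4 * s * B -> nu < xi -> 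
  xi = h * u + 9 * s * B -> 13 * s * B <= u -> tau <= u -> 0 < n ->
  t * xi <= J -> J < (t + 2 * n + 1) * xi -> s * (4 * n * xi) <= J ->
  J * s + s * ((nu + 1) * n + tau * t) <= nu * t * s + J * (2 * lam + (4 * B + 12)).
Proof.
move=> s0 lams hE es eE fE fB nuE nuxi xiE Bu tu n0 tJ Jt nJ.
have ss : s * s.-1 + s = s * s by rewrite -mulnSr prednK.
have gap : xi = nu + (3 * s + 2 * lam * s + 4 * lam * B + 6) * u + 13 * s * B.
  have -> : xi = (e - 2 * s + (3 * s + 2 * lam * s + 4 * lam * B + 6)) * u + 9 * s * B.
    by rewrite xiE; congr (_ * _ + _); lia.
  rewrite mulnDl -fE nuE; lia.
have xiu : s * s * u <= xi.
  by rewrite xiE hE -addnA mulnDl -addnA leq_addr.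
have main : s * (xi + tau - nu) <= s * s * u * (2 * lam + (4 * B + 11)).
  have h1 : xi + tau - nu <= (3 * s + 2 * lam * s + 4 * lam * B + 8) * u.
    rewrite gap; lia.
  apply: leq_trans (leq_mul (leqnn s) h1) _.
  rewrite (_ : s * s * u * _ = s * (s * (2 * lam + (4 * B + 11)) * u)); last by ring.
  rewrite leq_mul2l leq_mul2r; apply/orP; right; apply/orP; right.
  have lB : lam * B <= s * B by rewrite leq_mul2r lams orbT.
  move: lB s0; clear; lia.
have h2 : s * (xi + tau - nu) * t <= J * (2 * lam + (4 * B + 11)).
  apply: leq_trans (leq_mul main (leqnn t)) _.
  rewrite mulnAC leq_mul2r; apply/orP; right.
  apply: leq_trans tJ; rewrite mulnC leq_mul2l xiu orbT //.
have h3 : s * ((2 * n + 1) * xi + (nu + 1) * n) <= J.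
  apply: leq_trans nJ; rewrite leq_mul2l; apply/orP; right.
  have i1 : (nu + 1) * n <= xi * n by rewrite leq_mul2r addn1 nuxi orbT.
  have i2 : 1 * xi <= n * xi by rewrite leq_mul2r n0 orbT.
  move: i1 i2; clear; lia.
have h4 : J * s <= (t + 2 * n + 1) * xi * s by rewrite leq_mul2r ltnW ?orbT.
have h5 : s * (xi + tau - nu) * t + nu * t * s = (xi + tau) * t * s.
  have [z zE] : exists z, xi + tau = nu + z by exists (xi + tau - nu); lia.
  rewrite zE addKn; ring.
move: h2 h3 h4 h5; clear; lia.
Qed.

Lemma eventually_scale_conditions (B c0 l0 : nat) : exists s0, forall s, s0 <= s ->
  [/\ c0 + 2 <= s, l0 <= 2 ^ s, 64 * B * s ^ 2 <= 2 ^ s, 14 * s.+1 <= 2 ^ s & lg s <= s /\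
   8 * s * B + 2 * s + 2 + (2 * lg s * s + 2 * lg s * B + 4) <= s * s.-1].
Proof.
have [s1 h1] := eventually_pow (64 * B) 2.
have [s2 h2] := eventually_lg 8.
have [s3 h3] := eventually_pow 28 1.
exists (c0 + 2 + l0 + s1 + s2 + s3 + 40 * B.+1) => s hs.
have lams : 8 * lg s <= s by apply: h2; lia.
have s40 : 40 * B.+1 <= s by lia.
split.
- lia.
- by apply: leq_trans (ltnW (ltn_expl s (ltnSn 1))); lia.
- by apply: h1; lia.
- by apply: leq_trans (h3 s _); [rewrite expn1; lia|lia].
split; first lia.
have q1 : 40 * B.+1 * s <= s * s by rewrite leq_mul2r s40 orbT.
have q2 : 8 * lg s * s <= s * s by rewrite leq_mul2r lams orbT.
have q3 : 8 * lg s * B <= s * B by rewrite leq_mul2r lams orbT.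
have q4 : s * s.-1 + s = s * s by rewrite -mulnSr prednK //; lia.
move: q1 q2 q3 q4 s40; clear; lia.
Qed.

Lemma prime_large m : exists2 p, prime p & m < p.
Proof. by have [p mp p_pr] := prime_above m; exists p. Qed.

(** Here t is the largest number of pool primes that fits under 2 ^ J next to
    the fixed factors. The window for s guarantees both that n xi is
    negligible against J and that log t is at most u. *)
Theorem carmichael_log_dense (B l0 : nat) (a : int) (nu : nat) :
  linnik_bound B l0 -> 0 < B -> a != 0%R -> 0 < nu -> coprimez a (Posz nu) ->
  odd `|a|%N != odd nu -> log_dense (fun X => carmichael_ncount nu X a).
Proof.
move=> hyp B0 a0 nu0 anu par.
have [r r_pr ar] := prime_large (`|a|%N + 2).
have rodd : odd r by case: (even_prime r_pr) => // r2; move: ar; rewrite r2; lia.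
have ra : `|a|%N < r by lia.
pose c0 := lg (nu * r).
have nurc0 : nu * r < 2 ^ c0 by apply: ltn_lg.
have [s0 hs0] := eventually_scale_conditions B c0 l0.
exists (4 * B + 12), s0 => s /hs0[c0s l0s Cs s14 [lams Ds]] J Jge Jlt X leX.
set lam := lg s in lams Ds *.
have [[s2 c0sB es ss2] [F1 F3 F4 F5] [F6 F7 F8 F9] [F10 F11]] := scale_exponents B0 c0s Cs Ds.
have := carmichael_count_at_scale hyp B0 a0 nu0 anu par r_pr ra rodd nurc0 c0s l0s Cs Ds.
rewrite -/lam.
have eE : s * s.-1 - (2 * lam * s + 2 * lam * B + 4) + (2 * lam * s + 2 * lam * B + 4) = s * s.-1.
  by rewrite subnK //; apply: leq_trans Ds; rewrite leq_addl.
rewrite -/lam in F1 F3 F6 F8 F10 es.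
set h := s * s + 2 * lam * B + 2 in F1 F3 F8 *.
set e := s * s.-1 - _ in eE es F3 F10 *; set u := 2 ^ (2 * s) in F1 F7 F10 *.
set f := (e - 2 * s) * u in F10 *; set n := 2 ^ (2 * s * 2 ^ s).
set xi := h * u + 9 * s * B; set v := f - 4 * s * B => scale.
set Y := 2 ^ s in s14 Cs F6 F9 F10 Jge.
have uE : u = Y * Y by rewrite /u /Y -expnD addnn mul2n.
have sB0 : 0 < s * B by rewrite muln_gt0 B0 andbT; apply: ltnW.
have sBY : 13 * s * B <= Y.
  apply: leq_trans Cs; rewrite expnS expn1; move: F11; clear; nia.
have Y0 : 0 < Y by rewrite expn_gt0.
have Yu : Y <= u by rewrite uE leq_pmulr.
have f2 : 2 * u <= f.
  rewrite /f leq_mul2r; apply/orP; right.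
  by move: Ds eE es; rewrite /e; clear; lia.
have fB : 4 * s * B <= f by move: f2 sBY Yu sB0; clear; lia.
have uv : u <= v by rewrite /v; move: f2 sBY Yu sB0; clear; lia.
have vxi : v < xi.
  have : f <= h * u.
    rewrite /f leq_mul2r; apply/orP; right; rewrite /h.
    have : e <= s * s.-1 by apply: leq_subr.
    have : s * s.-1 <= s * s by rewrite leq_mul2l leq_pred orbT.
    clear; lia.
  by rewrite /v /xi; move: sB0; clear; lia.
have n0 : 0 < n by rewrite expn_gt0.
have sY : s < Y by apply: ltn_expl.
have xile : xi <= 2 ^ (3 * s + 1).
  have : Y <= 2 ^ (3 * s) by rewrite /Y leq_exp2l //; clear; lia.
  rewrite addn1 [X in _ -> _ <= X]expnS /xi; move: F1 sBY; clear; lia.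
have sYY : s + s <= s * Y by rewrite addnn -muln2 leq_mul2l (leq_ltn_trans _ sY) ?orbT //; lia.
have J0 : 0 < J.
  case: (posnP J) => // J0; move: Jge; rewrite J0 /lg trunc_log0 => h7.
  by move: sYY s2 h7; clear; lia.
have Jpow : 2 ^ (7 * s * Y).-1 <= J.
  apply: leq_trans (trunc_logP (ltnSn 1) J0); rewrite leq_exp2l //.
  by move: Jge; rewrite /lg; clear; lia.
have nJ : s * (4 * n * xi) <= J.
  apply: leq_trans Jpow.
  apply: leq_trans (_ : 2 ^ s * (2 ^ 2 * 2 ^ (2 * s * Y) * 2 ^ (3 * s + 1)) <= _).
    by rewrite leq_mul //; [apply: ltnW; apply: ltn_expl|rewrite leq_mul].
  rewrite -!expnD leq_exp2l //; move: sYY s2; rewrite -!mulnA; clear; lia.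
have xi0 : 0 < xi by apply: leq_ltn_trans vxi.
pose t := J %/ xi - 2 * n.
have tdiv : 4 * n <= J %/ xi.
  rewrite leq_divRL //; apply: leq_trans nJ; rewrite leq_pmull //; exact: ltnW.
have tE : t + 2 * n = J %/ xi by rewrite /t subnK //; move: tdiv; clear; lia.
have nt : n <= t by rewrite /t; move: tdiv; clear; lia.
have txi : (t + 2 * n) * xi <= J by rewrite tE leq_trunc_div.
have Jxi : J < (t + 2 * n + 1) * xi by rewrite tE addn1 ltn_ceil.
have t0 : t <= J.
  apply: leq_trans (_ : (t + 2 * n) * xi <= _) => //.
  by apply: leq_trans (leq_pmulr _ xi0); apply: leq_addr.
have tauu : lg J <= u.
  apply: leq_trans (ltnW Jlt) _; rewrite uE expnS -/Y.
  have : 14 * s.+1 * Y <= Y * Y by rewrite leq_mul2r s14 orbT.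
  by clear; lia.
have tN : t <= 2 ^ v.
  apply: leq_trans t0 _; apply: leq_trans (ltnW (ltn_lg J)) _.
  by rewrite leq_exp2l // (leq_trans tauu).
have txiX : 2 ^ (xi * (2 * n + t)) <= X.
  by apply: leq_trans leX; rewrite leq_exp2l // mulnC addnC.
have sc := scale t X nt txiX; set cnt := carmichael_ncount nu X a in sc *.
have low : 2 ^ (v * t) <= cnt * 2 ^ ((v + 1) * n + lg J * t).
  rewrite expnM; apply: leq_trans (bin_lower tN) _.
  rewrite expnD mulnA; apply: leq_mul.
    apply: leq_trans sc _; rewrite leq_mul2l; apply/orP; right.
    have N0 : 0 < 2 ^ v by rewrite expn_gt0.
    have N1 : (2 ^ v).+1 <= 2 ^ v.+1 by rewrite expnS; move: N0; move: (2 ^ v) => z; clear; lia.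
    by rewrite expnM leq_exp2r // addn1.
  rewrite expnM; case: (t) t0 => // t' t0; rewrite leq_exp2r //.
  by apply: leq_trans t0 _; apply: ltnW; apply: ltn_lg.
have low' : 2 ^ (v * t * s) <= cnt ^ s * 2 ^ (s * ((v + 1) * n + lg J * t)).
  rewrite [s * _]mulnC !(expnM _ _ s) -expnMn leq_exp2r //; exact: ltnW.
have su : 13 * s * B <= u by apply: leq_trans sBY Yu.
have bud := exponent_budget (ltnW s2) lams (erefl h) es eE (erefl f) fB (erefl v) vxi (erefl xi) su tauu n0
  (leq_trans _ txi) Jxi nJ.
rewrite -(leq_pmul2r (_ : 0 < 2 ^ (s * ((v + 1) * n + lg J * t)))) ?expn_gt0 //.
rewrite -expnD mulnAC.
apply: leq_trans (_ : 2 ^ (v * t * s + J * (2 * lam + (4 * B + 12))) <= _).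
  by rewrite leq_exp2l // bud // leq_mul2r leq_addr orbT.
by rewrite expnD leq_mul2r low' orbT.
Qed.

Lemma carmichael_ncount0_ge (X J : nat) : 0 < J -> 2 ^ J <= X ->
  size (primes_upto (2 ^ J.-1)) <= carmichael_ncount 1 X 0%R + 3.
Proof.
move=> J0 leX; set P := primes_upto _.
have Pu : uniq P by rewrite filter_uniq ?iota_uniq.
apply: leq_trans (count_gt 2 Pu) _; rewrite leq_add2r -size_filter.
set P' := [seq q <- P | 2 < q].
have P'u : uniq P' by apply: filter_uniq.
have P'P i : i < size P' -> [/\ prime (nth 0 P' i), 2 < nth 0 P' i & nth 0 P' i <= 2 ^ J.-1].
  move=> iP; have := mem_nth 0 iP; rewrite mem_filter => /andP[-> ].
  by rewrite mem_primes_upto => /andP[-> ->].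
rewrite -[X in X <= _](card_ord (size P')) -cardsT.
apply: (carmichael_ncount_ge (F := fun i : 'I_(size P') => \prod_(q <- [:: 2; nth 0 P' i]) q)).
  move=> i j _ _; rewrite !big_cons !big_nil !muln1 => /eqP.
  by rewrite eqn_pmul2l // nth_uniq // => /eqP/val_inj.
move=> i _; have [q_pr q2 qX] := P'P _ (ltn_ord i).
set q := nth 0 P' i in q_pr q2 qX *.
have s_pr : all prime [:: 2; q] by rewrite /= q_pr.
have us : uniq [:: 2; q] by rewrite /= inE andbT; apply: contraTN q2 => /eqP <-.
split.
- rewrite !big_cons big_nil muln1; apply: leq_trans leX.
  by rewrite -(prednK J0) expnS leq_mul2l qX orbT.
- rewrite /aa_carmichael squarefree_prod //=; apply/allP => p.
  by rewrite !subr0 mem_primes dvdzE => /and3P[].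
apply: (@carmichael_gcd_eq _ _ _ 2 q).
- by rewrite mem_primes_prod // inE eqxx.
- by rewrite mem_primes_prod // !inE eqxx orbT.
- rewrite !subr0 /gcdz /=; congr Posz; apply/eqP.
  rewrite -[_ == _]/(coprime 2 q) prime_coprime // dvdn_prime2 //.
  by apply: contraTN q2 => /eqP <-.
by move=> r _; rewrite dvdzE /= dvd1n.
Qed.

(** For a = 0 the divisibility condition is void, and twice the odd primes
    provide cnt X >= X / O(log X), far more than required. *)
Theorem carmichael_log_dense0 : log_dense (fun X => carmichael_ncount 1 X 0%R).
Proof.
have [s0 hs0] := eventually_pow 4 2.
exists 0, (s0 + 4) => s hs J Jge Jlt X leX.
set tau := lg J in Jge Jlt *.
have s4 : 4 <= s by lia.
have stau : s <= tau.
  apply: leq_trans Jge; rewrite -mulnA mulnCA leq_pmulr // muln_gt0 expn_gt0 //.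
have tau4 : 4 <= tau by apply: leq_trans stau.
have J0 : 0 < J.
  by case: (posnP J) => // J0; move: tau4; rewrite /tau J0 /lg trunc_log0.
have tauJ : tau * (tau + 4) <= J.
  have h1 : 4 * tau ^ 2 <= 2 ^ tau by apply: hs0; apply: leq_trans stau; lia.
  have h2 : 2 ^ tau <= 2 * J.
    by rewrite /tau /lg expnS leq_mul2l trunc_logP.
  move: h1 h2; rewrite expnS expn1; nia.
have J32 : 32 <= J by apply: leq_trans tauJ; nia.
have := chebyshev_pow2 (_ : 0 < J.-1); have := carmichael_ncount0_ge J0 leX.
set cnt := carmichael_ncount _ _ _; set pi := size _ => pic /(_ _) cheb.
have {cheb} : 2 ^ J.-2 <= J * (cnt + 3).
  apply: leq_trans (cheb _) _; first by lia.
  by rewrite leq_mul // leq_pred.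
move=> cheb.
have J3 : 3 * J < 2 ^ J.-2.
  have [j ->] : exists j, J = j + 32 by exists (J - 32); lia.
  rewrite (_ : (j + 32).-2 = j + 30) ?expnD; last by lia.
  have : j < 2 ^ j by apply: ltn_expl.
  have : 128 <= 2 ^ 30 by rewrite -[128]/(2 ^ 7) leq_exp2l.
  nia.
have cnt0 : 0 < cnt.
  by rewrite lt0n; apply: contraTneq cheb => ->; rewrite -ltnNge; lia.
have cntJ : 2 ^ J <= cnt * 2 ^ (tau + 4).
  rewrite (_ : J = J.-2 + 2) ?expnD; last by lia.
  apply: leq_trans (leq_mul cheb (leqnn _)) _.
  have : J < 2 ^ tau by apply: ltn_lg.
  rewrite (_ : 2 ^ 4 = 16) // (_ : 2 ^ 2 = 4) //; move: cnt0; clear; nia.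
have scnt : 2 ^ (J * s) <= cnt ^ s * 2 ^ ((tau + 4) * s).
  by rewrite !(expnM _ _ s) -expnMn leq_exp2r //; apply: leq_trans s4.
apply: leq_trans scnt _; rewrite leq_mul2l leq_exp2l // addn0; apply/orP; right.
apply: leq_trans (_ : J <= _); last by rewrite leq_pmulr.
by apply: leq_trans tauJ; rewrite mulnC leq_mul2r stau orbT.
Qed.

From mathcomp Require Import all_classical all_reals all_analysis.

Import numFieldNormedType.Exports.

Local Open Scope classical_set_scope.
Local Open Scope ring_scope.

(** * Asymptotics over the reals *)

Lemma ln_homo (R : realType) (x y : R) : 0 < x -> x <= y -> ln x <= ln y.
Proof. by move=> x0 xy; rewrite ler_ln ?posrE // (lt_le_trans x0). Qed.

Lemma le_ln_expR (R : realType) (c x : R) : expR c <= x -> c <= ln x.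
Proof. by move=> cx; rewrite -[c in c <= _]expRK; apply: ln_homo => //; apply: expR_gt0. Qed.

Lemma ln_natpow2 (R : realType) (n : nat) : ln ((2 ^ n)%N%:R : R) = n%:R * ln 2.
Proof. by rewrite natrX lnXn ?ltr0n // mulr_natl. Qed.

Lemma ln2_bounds (R : realType) : 1 / 2 <= ln (2 : R) <= 1.
Proof.
apply/andP; split; last first.
  by have := @le_ln1Dx R 1; rewrite (_ : 1 + 1 = 2); last ring; apply; lra.
have := @le_ln1Dx R (- (1 / 2)); rewrite (_ : 1 + - (1 / 2) = 2^-1); last by field.
rewrite lnV ?posrE ?ltr0n //; lra.
Qed.

(** Since ln l <= lg l and lg l >= 1, the exponent A may be rounded up to an
    integer. *)
Lemma linnik_of_small_primes (R : realType) (A : R) :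
  2 <= A -> small_primes_in_progressions A -> exists B l0, (0 < B)%N /\ linnik_bound B l0.
Proof.
move=> A2 [l0 hl0]; exists (Num.truncn A).+1, l0; split=> // l l_gt0 ll b bl.
have [p [p_pr pb ltp]] := hl0 l l_gt0 ll b bl; exists p; split=> //.
rewrite -(ltr_nat R); apply: lt_le_trans ltp _.
rewrite natrM ler_wpM2l ?ler0n // natrX -powR_mulrn ?ler0n //.
have l1 : (1 : R) <= l%:R by rewrite ler1n.
have ln_le_lg : ln (l%:R : R) <= (lg l)%:R.
  apply: le_trans (_ : ln ((2 ^ lg l)%N%:R : R) <= _).
    by apply: ln_homo; rewrite ?ltr0n // ler_nat ltnW // ltn_lg.
  rewrite ln_natpow2 ler_piMr ?ler0n //; by have /andP[] := ln2_bounds R.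
have A0 : 0 <= A by lra.
apply: le_trans (ler_powR _ (ltW (truncnS_gt A))); last by rewrite ler1n.
by apply: ge0_ler_powR => //; rewrite nnegrE ?ler0n // ln_ge0.
Qed.

Lemma scale_index (s1 tau : nat) : (7 * s1 * 2 ^ s1 <= tau)%N ->
  exists s, [/\ (s1 <= s)%N, (7 * s * 2 ^ s <= tau)%N & (tau < 7 * s.+1 * 2 ^ s.+1)%N].
Proof.
move=> h1; pose P s := (7 * s * 2 ^ s <= tau)%N.
have bd s : P s -> (s <= tau)%N.
  by apply: leq_trans; rewrite mulnC mulnA leq_pmull // muln_gt0 expn_gt0.
have exP : exists s, P s by exists s1.
have [s Ps smax] := ex_maxnP exP bd.
exists s; split=> //; first exact: smax.
by rewrite ltnNge; apply/negP => /smax; rewrite ltnn.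
Qed.

(** Taking logarithms in the density inequality bounds ln c / ln X from below
    by 1 - D / s, up to the ratio of J to J + 1, which costs at most 1 / s. *)
Lemma defect_of_count (R : realType) (X : R) (s J D c : nat) :
  (0 < s)%N -> (s <= J.+1)%N -> (2 ^ (J * s) <= c ^ s * 2 ^ (J * D))%N ->
  (2 ^ J)%N%:R <= X -> X < (2 ^ J.+1)%N%:R -> 0 < ln X ->
  (0 < c)%N /\ 1 - ln (c%:R : R) / ln X <= (D.+1)%:R / s%:R.
Proof.
move=> s0 sJ hc XJ JX lnX0.
have c0 : (0 < c)%N.
  rewrite lt0n; apply: contraTneq hc => ->.
  by rewrite exp0n // mul0n -ltnNge expn_gt0.
split=> //.
have X0 : 0 < X by apply: lt_le_trans XJ; rewrite ltr0n expn_gt0.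
have c1 : (1 : R) <= c%:R by rewrite ler1n.
have lnc0 : 0 <= ln (c%:R : R) by rewrite ln_ge0.
have /andP[l2 _] := ln2_bounds R; set l := ln 2 in l2.
have lnX : ln X <= (J.+1)%:R * l.
  by rewrite -ln_natpow2; apply: ln_homo => //; apply: ltW.
have sR : 0 < s%:R :> R by rewrite ltr0n.
have lnc : (J * s)%:R * l <= s%:R * ln (c%:R : R) + (J * D)%:R * l.
  have : ln ((2 ^ (J * s))%N%:R : R) <= ln ((c ^ s * 2 ^ (J * D))%N%:R).
    by apply: ln_homo; rewrite ?ltr0n ?expn_gt0 // ler_nat.
  rewrite natrM lnM ?posrE ?ltr0n ?expn_gt0 ?c0 // !ln_natpow2 natrX lnXn ?ltr0n //.
  by rewrite -[ln c%:R *+ s]mulr_natl.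
rewrite lerBlDr -lerBlDl ler_pdivlMr //.
set rho := D.+1%:R / s%:R.
have [rho1|rho1] := leP 1 rho.
  apply: le_trans lnc0; nra.
have sJ' : s%:R <= (J.+1)%:R :> R by rewrite ler_nat.
have rs : rho * s%:R = D.+1%:R by rewrite /rho divfK // gt_eqF.
have h1 : (1 - rho) * ln X <= (1 - rho) * (J.+1%:R * l) by rewrite ler_wpM2l //; lra.
apply: le_trans h1 _; rewrite -(ler_pM2l sR).
move: lnc; rewrite !natrM -!natr1 in sJ' rs * => lnc.
have -> : s%:R * ((1 - rho) * ((J%:R + 1) * l)) = (s%:R - rho * s%:R) * (J%:R + 1) * l by ring.
rewrite rs.
have : 0 <= l * (J%:R + 1 + D%:R - s%:R).
  by apply: mulr_ge0; have := ler0n R D; lra.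
move: lnc; lra.
Qed.

Lemma ln_div_decr (R : realType) (w W : R) :
  0 < w -> 1 <= ln w -> w <= W -> ln W / W <= ln w / w.
Proof.
move=> w0 lw wW; have W0 := lt_le_trans w0 wW.
rewrite ler_pdivrMr // mulrAC ler_pdivlMr // mulrC.
have h : ln (W / w) <= W / w - 1.
  have := @le_ln1Dx R (W / w - 1); rewrite addrCA subrr addr0; apply.
  have Ww : 0 < W / w by apply: divr_gt0.
  by move: Ww; lra.
move: h; rewrite ln_div ?posrE // => h.
have h2 : w * (ln W - ln w) <= W - w.
  rewrite (_ : W - w = w * (W / w - 1)); first by apply: ler_wpM2l => //; apply: ltW.
  by field; rewrite gt_eqF.
have h3 : 0 <= (W - w) * (ln w - 1) by apply: mulr_ge0; lra.
nra.
Qed.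

(** The upper end of the window gives lg J < 14 (s + 1) 2 ^ s, and three
    logarithms bring X down to the logarithm of that. *)
Lemma lnlnln_upper (R : realType) (X : R) (s J : nat) :
  X < (2 ^ J.+1)%N%:R -> (lg J < 7 * s.+1 * 2 ^ s.+1)%N ->
  0 < X -> 0 < ln X -> 0 < ln (ln X) ->
  ln (ln (ln X)) <= ln 2 * (s + lg s + 4)%N%:R.
Proof.
move=> XJ Js X0 l0 ll0; have /andP[_ l21] := ln2_bounds R.
have lX : ln X <= (2 ^ lg J)%N%:R.
  apply: le_trans (ln_homo X0 (ltW XJ)) _; rewrite ln_natpow2.
  apply: le_trans (_ : J.+1%:R <= _); first by rewrite ler_piMr ?ler0n.
  by rewrite ler_nat ltn_lg.
have llX : ln (ln X) <= (lg J)%:R.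
  apply: le_trans (ln_homo l0 lX) _; rewrite ln_natpow2.
  by rewrite ler_piMr ?ler0n.
rewrite mulrC -ln_natpow2; apply: ln_homo => //; apply: le_trans llX _.
rewrite ler_nat; apply: leq_trans (ltnW Js) _.
rewrite expnS (_ : 7 * s.+1 * (2 * 2 ^ s) = 2 ^ s * s.+1 * 14)%N; last by ring.
rewrite !expnD !leq_mul //; exact: ltn_lg.
Qed.

(** With g = lg s, both sides are of order g / s: the left one is (2 g + O(1))
    / s, the right one (2 + eps) (g - O(1)) / s up to a factor 1 + o(1), and
    eps g outgrows the constants. *)
Lemma scale_defect_le (R : realType) (C : nat) (eps : R) : 0 < eps ->
  exists s1, forall s, (s1 <= s)%N ->
  (2 * lg s + C).+1%:R / s%:R <= (2 + eps) * (((lg s)%:R - 2) / (s + lg s + 4)%N%:R) /\ (4 < lg s)%N.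
Proof.
move=> eps0; have [g0 hg0] := eventually_pow (10 * (C + 3)) 2.
pose G := (Num.truncn ((C%:R + 6) / eps)).+4.
exists (2 ^ (g0 + G))%N => s hs.
have s0 : (0 < s)%N by apply: leq_trans hs; rewrite expn_gt0.
have gG : (g0 + G < lg s)%N by rewrite ltnS; apply: trunc_log_max.
split; last by apply: leq_trans gG; rewrite /G; lia.
set g := lg s in gG *.
have small : ((2 * g + C).+1 * (g + 4) <= s)%N.
  have h1 : (10 * (C + 3) * g ^ 2 <= 2 ^ g)%N by apply: hg0; lia.
  have h2 : (2 ^ g <= 2 * s)%N by rewrite /g /lg expnS leq_mul2l trunc_logP.
  have h3 : ((2 * g + C).+1 <= (C + 3) * g)%N by nia.
  have h4 : (g + 4 <= 5 * g)%N by lia.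
  have := leq_mul h3 h4; move: h1 h2; rewrite expnS expn1; clear; nia.
have sR : 0 < s%:R :> R by rewrite ltr0n.
have dR : 0 < (s + g + 4)%N%:R :> R by rewrite ltr0n addn4.
rewrite ler_pdivrMr // mulrA -mulrAC ler_pdivlMr //.
have smallR : (2 * g + C).+1%:R * (g%:R + 4) <= s%:R :> R.
  by rewrite -natrD -natrM ler_nat.
have gR : (C%:R + 6) / eps + 2 <= g%:R.
  apply: le_trans (_ : ((Num.truncn ((C%:R + 6) / eps)).+1 + 2)%N%:R <= _).
    by rewrite natrD lerD2r ltW // truncnS_gt.
  rewrite ler_nat; apply: leq_trans (ltnW gG); rewrite /G; lia.
have ge : C%:R + 6 <= eps * (g%:R - 2).
  have : (C%:R + 6) / eps <= g%:R - 2 by lra.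
  by rewrite ler_pdivrMr // mulrC.
move: smallR; rewrite !natrD -natr1 natrD natrM => smallR.
have := mulr_ge0 (ltW sR) (_ : 0 <= eps * (g%:R - 2) - (C%:R + 6)); rewrite subr_ge0 => /(_ ge).
move: smallR; clear; lra.
Qed.

(** Put w = ln (ln (ln X)). As ln w / w decreases, it is at least its value at
    the upper bound ln 2 * (s + lg s + 4) for w, and that value exceeds (lg s
    - 2) / (s + lg s + 4); [scale_defect_le] concludes. *)
Theorem log_dense_defect (R : realType) (cnt : nat -> nat) (eps : R) :
  log_dense cnt -> 0 < eps ->
  exists X0 : R, forall X, X0 <= X ->
    [/\ (0 < cnt (Num.truncn X))%N, 0 < ln X, 0 < ln (ln (ln (ln X))) / ln (ln (ln X)) &
     1 - ln ((cnt (Num.truncn X))%:R : R) / ln X <=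
       (2 + eps) * (ln (ln (ln (ln X))) / ln (ln (ln X)))].
Proof.
move=> [C [s0 hs0]] eps0; have [s1 hs1] := scale_defect_le C eps0.
have eps2 : 0 <= 2 + eps by lra.
have /andP[l2 l21] := ln2_bounds R.
have l0 : 0 < ln 2 :> R by lra.
set S := (s0 + s1 + 1)%N; set T := (7 * S * 2 ^ S)%N.
exists (expR (expR (expR (expR 1))) + (2 ^ (2 ^ T))%N%:R) => X hX.
have XT : (2 ^ (2 ^ T))%N%:R <= X by apply: le_trans hX; rewrite lerDr expR_ge0.
have XE : expR (expR (expR (expR 1))) <= X by apply: le_trans hX; rewrite lerDl ler0n.
have L1 := le_ln_expR XE; have L2 := le_ln_expR L1; have L3 := le_ln_expR L2; have L4 := le_ln_expR L3.
have X0 : 0 < X by apply: lt_le_trans XE; apply: expR_gt0.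
have lX0 : 0 < ln X by apply: lt_le_trans L1; apply: expR_gt0.
have llX0 : 0 < ln (ln X) by apply: lt_le_trans L2; apply: expR_gt0.
have w0 : 0 < ln (ln (ln X)) by apply: lt_le_trans L3; apply: expR_gt0.
set n := Num.truncn X.
have Tn : (2 ^ (2 ^ T) <= n)%N by rewrite truncn_ge_nat // ltW.
have n0 : (0 < n)%N by apply: leq_trans Tn; rewrite expn_gt0.
set J := trunc_log 2 n.
have JT : (2 ^ T <= J)%N by apply: trunc_log_max.
have TJ : (T <= lg J)%N by apply: ltnW; rewrite ltnS; apply: trunc_log_max.
have [s [sS slo shi]] := scale_index TJ.
clear hX XT Tn JT TJ T.
have Jn : (2 ^ J <= n)%N by apply: trunc_logP.
have XJ : X < (2 ^ J.+1)%N%:R.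
  by apply: lt_le_trans (truncnS_gt X) _; rewrite ler_nat trunc_log_ltn.
have JX : (2 ^ J)%N%:R <= X.
  by apply: le_trans (_ : n%:R <= _); rewrite ?ler_nat // truncn_le ltW.
have dense := hs0 s _ J slo shi n Jn.
have spos : (0 < s)%N by move: sS; rewrite /S; clear; lia.
have sJ : (s <= J.+1)%N.
  apply: leq_trans (_ : lg J <= _)%N.
    by apply: leq_trans slo; rewrite mulnC mulnA leq_pmull // muln_gt0 expn_gt0.
  by apply: lg_le => //; apply: ltnW; apply: ltn_expl.
have [|c0 def] := defect_of_count spos sJ (dense _) JX XJ lX0; first by move: sS; rewrite /S; clear; lia.
split; [exact: c0|exact: lX0| |].
  by apply: divr_gt0 w0; apply: lt_le_trans L4.
apply: le_trans def _.
have [|h1 g4] := hs1 s; first by move: sS; rewrite /S; clear; lia.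
apply: le_trans h1 _; apply: ler_wpM2l => //.
have wW := lnlnln_upper XJ shi X0 lX0 llX0.
set w := ln (ln (ln X)) in w0 wW L4 *.
apply: le_trans (ln_div_decr w0 L4 wW).
set d := (s + lg s + 4)%N%:R.
have d0 : 0 < d :> R by rewrite ltr0n addn4.
have lW : ((lg s)%:R - 2) * ln 2 <= ln (ln 2 * d).
  rewrite lnM ?posrE //.
  have half : - ln 2 <= ln (ln 2 : R).
    by rewrite -lnV ?posrE ?ltr0n //; apply: ln_homo; rewrite ?invr_gt0 ?ltr0n // -div1r.
  have ds : ((lg s).-1)%:R * ln 2 <= ln d.
    rewrite -ln_natpow2; apply: ln_homo; first by rewrite ltr0n expn_gt0.
    by rewrite ler_nat (leq_trans (trunc_logP (ltnSn 1) spos)) // -addnA leq_addr.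
  have lgE : (lg s)%:R = (lg s).-1%:R + 1 :> R by rewrite natr1.
  have -> : ((lg s)%:R - 2) * ln 2 = - ln 2 + (lg s).-1%:R * ln 2 :> R.
    by rewrite lgE; ring.
  exact: lerD.
rewrite ler_pdivrMr // mulrAC ler_pdivlMr; last by apply: mulr_gt0.

by rewrite mulrA; apply: (ler_wpM2r (ltW d0)).
Qed.

Lemma carmichael_count_dense (R : realType) (a : int) (nu : nat) :
  (exists A : R, 2 <= A /\ small_primes_in_progressions A) ->
  (0 < nu)%N -> coprimez a nu%:Z -> odd `|a|%N != odd nu ->
  log_dense (fun X => carmichael_ncount nu X a).
Proof.
move=> [A [A2 hA]] nu0 anu par.
have [B [l0 [B0 hyp]]] := linnik_of_small_primes A2 hA.
have [a0|a0] := eqVneq a 0; last exact: carmichael_log_dense hyp B0 a0 nu0 anu par.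
move: anu; rewrite a0 coprimez_nat /= /coprime gcd0n => /eqP ->.
exact: carmichael_log_dense0.
Qed.

Theorem theorem1 (R : realType)
    (hprimes : exists A : R, 2 <= A /\ small_primes_in_progressions A)
    (a : int) (nu : nat) (hnu : (0 < nu)%N)
    (hcoprime : coprimez a nu%:Z)
    (hparity : odd `|a|%N != odd nu) :
  exists e : R -> R,
    (e X @[X --> +oo] --> (0 : R)) /\
    (\forall X \near +oo,
      X `^ (1 - (2 + e X) * (ln (ln (ln (ln X))) / ln (ln (ln X))))
        <= (carmichael_count nu X a)%:R).
Proof.
have dense := carmichael_count_dense hprimes hnu hcoprime hparity.
pose rate (X : R) : R := ln (ln (ln (ln X))) / ln (ln (ln X)).
pose defect (X : R) : R := 1 - ln ((carmichael_count nu X a)%:R : R) / ln X.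
(* The least e that makes the inequality hold, cut off at 0. *)
exists (fun X => Num.max 0 (defect X / rate X - 2)); split.
  apply/cvgrPdist_le => eps eps0.
  have [X0 hX0] := log_dense_defect dense eps0.
  near=> X.
  have [|_ _ rate0 def] := hX0 X; first by near: X; apply: nbhs_pinfty_ge; apply: num_real.
  rewrite sub0r normrN ger0_norm ?le_max ?lexx //.
  rewrite ge_max (ltW eps0) lerBlDl ler_pdivrMr //.
have [X0 hX0] := log_dense_defect dense (ltr01 : 0 < (1 : R)).
near=> X.
have [|cnt0 lX0 rate0 _] := hX0 X; first by near: X; apply: nbhs_pinfty_ge; apply: num_real.
have X0' : 0 < X by near: X; apply: nbhs_pinfty_gt; apply: num_real.
rewrite -/(rate X) in rate0 *.
set E := Num.max _ _.
have cnt0' : 0 < (carmichael_count nu X a)%:R :> R by rewrite ltr0n.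
rewrite /powR gt_eqF // -[leRHS]lnK ?posrE // ler_expR -ler_pdivlMr //.
have : defect X / rate X - 2 <= E by rewrite le_max lexx orbT.
rewrite lerBlDl ler_pdivrMr // /defect; lra.
Unshelve. all: by end_near.
Qed.
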